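(* Let $X=(x_{ij})_{1\le i,j\le n}$ be chosen uniformly from the set of $n\times n$ doubly stochastic matrices, and let $B>4$ be a constant. Then \[ \mathbb{P}\big(n^{-B}\le n\,x_{11}\le B\log n\big)\ge 1-O\big(n^{-B/2}\big) \] as $n\to\infty$.
   Context: A real $n\times n$ matrix is doubly stochastic if its entries are nonnegative and all row and column sums equal $1$; ''chosen uniformly'' means according to normalized Lebesgue measure on the set of such matrices, identified via $X\mapsto(x_{ij})_{2\le i,j\le n}$ with a full-dimensional convex body in $\mathbb{R}^{(n-1)^2}$. *)

(* Defs.v *)
From HB Require Import structures.
From mathcomp Require Import all_boot all_order all_algebra.
From mathcomp Require Import all_classical all_reals all_analysis.
Set Implicit Arguments.
Unset Strict Implicit.
Unset Printing Implicit Defensive.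
Import Order.TTheory GRing.Theory Num.Theory.
Local Open Scope classical_set_scope.
Local Open Scope ring_scope.

Section cons_measure.
Context d (T : measurableType d) (R : realType) (n : nat).

Definition cons_tuple (p : T * n.-tuple T) : n.+1.-tuple T :=
  [tuple of p.1 :: p.2].

Lemma measurable_cons_tuple : measurable_fun [set: T * n.-tuple T] cons_tuple.
Proof. exact: measurable_cons measurable_fst measurable_snd. Qed.

(* The product of mu and nu, transported along T * T^n -> T^(n+1). *)
Definition cons_measure (mu : set T -> \bar R) (nu : set (n.-tuple T) -> \bar R)
    : set (n.+1.-tuple T) -> \bar R :=
  pushforward (mu \x nu)%E cons_tuple.

Variables (mu : {sigma_finite_measure set T -> \bar R})
  (nu : {sigma_finite_measure set (n.-tuple T) -> \bar R}).

Let cons_measure0 : cons_measure mu nu set0 = 0%E.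
Proof. by rewrite /cons_measure /pushforward preimage_set0 measure0. Qed.

Let cons_measure_ge0 A : (0 <= cons_measure mu nu A)%E.
Proof. by apply: integral_ge0 => *; exact: measure_ge0. Qed.

Let cons_measure_semi_sigma_additive : semi_sigma_additive (cons_measure mu nu).
Proof.
pose pm : {measure set (n.+1.-tuple T) -> \bar R} :=
  measure_function_pushforward__canonical__measure_function_Measure
    (mu \x nu)%E measurable_cons_tuple.
exact: (@measure_semi_sigma_additive _ _ _ pm).
Qed.

HB.instance Definition _ := isMeasure.Build _ _ _ (cons_measure mu nu)
  cons_measure0 cons_measure_ge0 cons_measure_semi_sigma_additive.

Let cons_measure_sigma_finite : sigma_finite setT (cons_measure mu nu).
Proof.
pose uncons (t : n.+1.-tuple T) := (thead t, [tuple of behead t] : n.-tuple T).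
have muncons : measurable_fun setT uncons.
  apply/measurable_fun_pair; first exact: measurable_tnth.
  exact: measurable_behead.
have consK : uncons \o cons_tuple = id.
  by apply/funext => -[x t]; congr pair => //; exact: val_inj.
have /sigma_finiteP[F [TF ndF Foo]] := sigma_finiteT mu.
have /sigma_finiteP[G [TG ndG Goo]] := sigma_finiteT nu.
exists (fun k => uncons @^-1` (F k `*` G k)) => [|k].
  rewrite -preimage_bigcup (_ : \bigcup_k _ = setT) ?preimage_setT//.
  apply/seteqP; split => // -[x y] _.
  have [i _ Fx] : (\bigcup_i F i) x by rewrite -TF.
  have [j _ Gy] : (\bigcup_i G i) y by rewrite -TG.
  exists (maxn i j) => //; split => /=.
  - by move: x Fx; exact/subsetPset/ndF/leq_maxl.
  - by move: y Gy; exact/subsetPset/ndG/leq_maxr.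
have [mF Fk] := Foo k; have [mG Gk] := Goo k; split.
  by rewrite -[X in measurable X]setTI; apply: muncons => //; exact: measurableX.
rewrite /cons_measure /pushforward -comp_preimage consK preimage_id.
by rewrite product_measure1E// lte_mul_pinfty// ge0_fin_numE.
Qed.

HB.instance Definition _ := Measure_isSigmaFinite.Build _ _ _
  (cons_measure mu nu) cons_measure_sigma_finite.

End cons_measure.

Section power_measure.
Context d (T : measurableType d) (R : realType).

(* The n-fold product measure of mu with itself. *)
Fixpoint power_measure (mu : set T -> \bar R) n : set (n.-tuple T) -> \bar R :=
  match n with
  | 0 => \d_([tuple] : 0.-tuple T)
  | m.+1 => cons_measure mu (@power_measure mu m)
  end.

Variable mu : {sigma_finite_measure set T -> \bar R}.

Lemma power_measure_subproof n :
  exists m : {sigma_finite_measure set (n.-tuple T) -> \bar R},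
    @power_measure mu n = m.
Proof.
elim: n => [|n [m IH]]; first by exists (\d_([tuple] : 0.-tuple T)).
by exists (cons_measure mu m); rewrite /= IH.
Qed.

Let power_measure0 n : @power_measure mu n set0 = 0%E.
Proof. by have [m ->] := power_measure_subproof n; exact: measure0. Qed.

Let power_measure_ge0 n A : (0 <= @power_measure mu n A)%E.
Proof. by have [m ->] := power_measure_subproof n; exact: measure_ge0. Qed.

Let power_measure_semi_sigma_additive n :
  semi_sigma_additive (@power_measure mu n).
Proof.
by have [m ->] := power_measure_subproof n; exact: measure_semi_sigma_additive.
Qed.

HB.instance Definition _ n := isMeasure.Build _ _ _ (@power_measure mu n)
  (@power_measure0 n) (@power_measure_ge0 n)
  (@power_measure_semi_sigma_additive n).

Let power_measure_sigma_finite n : sigma_finite setT (@power_measure mu n).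
Proof. by have [m ->] := power_measure_subproof n; exact: sigma_finiteT. Qed.

HB.instance Definition _ n := Measure_isSigmaFinite.Build _ _ _
  (@power_measure mu n) (@power_measure_sigma_finite n).

Lemma power_measure_box n (A : 'I_n -> set T) : (forall i, measurable (A i)) ->
  @power_measure mu n [set t | forall i, A i (tnth t i)] =
  (\prod_(i < n) mu (A i))%E.
Proof.
elim: n => [|n IH] in A * => mA.
  by rewrite big_ord0 /= /dirac indicE mem_set//= => -[].
rewrite big_ord_recl -IH//=.
set B := [set t : n.-tuple T | forall i, A (lift ord0 i) (tnth t i)].
have mB : measurable B.
  have -> : B = \bigcap_(i in [set: 'I_n])
      ((@tnth n T ^~ i) @^-1` A (lift ord0 i)).
    by apply/seteqP; split => t /= Bt i; [move=> _|]; exact: Bt.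
  apply: fin_bigcap_measurable => // i _; rewrite -[X in measurable X]setTI.
  exact: measurable_tnth.
rewrite -product_measure1E// /cons_measure /pushforward; congr product_measure1.
apply/seteqP; split => -[x t] /=.
  move=> At; split => [|i]; first exact: (At ord0).
  by have := At (lift ord0 i); rewrite /cons_tuple tnthS.
move=> [Ax Bt] i; have [->//|i0] := eqVneq i ord0.
by have /unlift_some[j -> _] : ord0 != i; rewrite 1?eq_sym// tnthS; exact: Bt.
Qed.

End power_measure.

(* Lebesgue measure on R^k, on the product sigma-algebra of k-tuples. *)
Definition lebesgue_tuple (R : realType) (k : nat) :
    set (k.-tuple (measurableTypeR R)) -> \bar R :=
  @power_measure _ (measurableTypeR R) R (@lebesgue_measure R) k.

HB.instance Definition _ (R : realType) (k : nat) :=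
  SigmaFiniteMeasure.copy (@lebesgue_tuple R k)
    (@power_measure _ (measurableTypeR R) R (@lebesgue_measure R) k).

Lemma lebesgue_tuple_box (R : realType) (k : nat) (a b : 'I_k -> R) :
  (forall i, a i <= b i) ->
  lebesgue_tuple [set t | forall i, a i <= tnth t i <= b i] =
  (\prod_(i < k) (b i - a i))%:E.
Proof.
move=> ab.
have E : [set t : k.-tuple (measurableTypeR R) | forall i, a i <= tnth t i <= b i]
    = [set t | forall i, `[a i, b i]%classic (tnth t i)].
  by apply/seteqP; split => t /= ht i; have := ht i; rewrite in_itv.
rewrite E; have /= := @power_measure_box _ _ R (@lebesgue_measure R) k
  (fun i => `[a i, b i]%classic) (fun i => measurable_itv _).
rewrite /lebesgue_tuple => ->; rewrite -prodEFin; apply: eq_bigr => i _.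
rewrite lebesgue_measure_itv/= lte_fin; case: ltgtP (ab i) => //= -> _.
by rewrite subrr.
Qed.

Section uniform_doubly_stochastic.
Context {R : realType}.

Definition doubly_stochastic n : set 'M[R]_n :=
  [set X | [/\ forall i j, 0 <= X i j,
               forall i, \sum_(j < n) X i j = 1 &
               forall j, \sum_(i < n) X i j = 1]].
Arguments doubly_stochastic n _ : clear implicits.

(* X |-> (x_ij)_(2 <= i, j <= n+1), the matrix X being of size n+1: the first
   row and column are deleted and the remaining entries are listed in the order
   of mxvec. *)
Definition minor_coords n (X : 'M[R]_n.+1) :
    (n * n).-tuple (measurableTypeR R) :=
  let Y : 'M[R]_n := row' ord0 (col' ord0 X) in
  [tuple mxvec Y ord0 k | k < n * n].

Lemma minor_coordsE n (X : 'M[R]_n.+1) (i j : 'I_n) :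
  tnth (minor_coords X) (mxvec_index i j) = X (lift ord0 i) (lift ord0 j).
Proof. by rewrite tnth_mktuple mxvecE !mxE. Qed.

Lemma minor_coords_inj n :
  {in doubly_stochastic n.+1 &, injective (@minor_coords n)}.
Proof.
move=> X Y /set_mem[_ rX cX] /set_mem[_ rY cY] XY.
have eqM i j : X (lift ord0 i) (lift ord0 j) = Y (lift ord0 i) (lift ord0 j).
  by rewrite -!minor_coordsE XY.
have eqC i : X (lift ord0 i) ord0 = Y (lift ord0 i) ord0.
  have := rX (lift ord0 i); rewrite -(rY (lift ord0 i)) !big_ord_recl.
  by under eq_bigr do rewrite eqM; exact: addIr.
have eqR j : X ord0 j = Y ord0 j.
  have := cX j; rewrite -(cY j) !big_ord_recl.
  under eq_bigr => i _.
    rewrite (_ : X _ j = Y (lift ord0 i) j); last first.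
      by have [k ->|->] := unliftP ord0 j; [exact: eqM|exact: eqC].
    over.
  exact: addIr.
apply/matrixP => i j; have [k ->|->//] := unliftP ord0 i.
by have [l ->|->] := unliftP ord0 j.
Qed.

(* P(X \in E) for X uniform in the doubly stochastic matrices of size n+1:
   normalized Lebesgue measure in the coordinates minor_coords. *)
Definition uniform_ds n (E : set 'M[R]_n.+1) : \bar R :=
  (lebesgue_tuple (@minor_coords n @` (doubly_stochastic n.+1 `&` E)) /
   lebesgue_tuple (@minor_coords n @` doubly_stochastic n.+1))%E.

End uniform_doubly_stochastic.

(* Main.v *)
(* Upper tail: by the Brunn-Minkowski inequality the survival function S of
   x_11 is log-concave, and since the entries of the first row are exchangeable
   with sum 1, the Riemann sums of S over [0, 1] are at most 1/n. With
   T = B log n, if S(T/n) > e^(-T/2) then S(u/n) >= e^(-u/2) for all u <= T by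
   log-concavity, and the Riemann sums of u |-> S(u/n) get close to
   2 (1 - e^(-T/2)) > 1, a contradiction.

   Lower tail: if x_11 < e with e tiny, some x_1j and some x_i1 are at least
   1/(2n). Adding s to x_11 and x_ij and subtracting it from x_1j and x_i1 is a
   translation of the coordinate x_ij alone, and the translates for
   s = 0, e, 2e, .. up to 1/(2n) are disjoint. Hence P(x_11 < e) is at most
   about 2 n^3 e, which is of order n^(2 - B) <= n^(-B/2). *)
Require Import Defs.
From mathcomp Require Import all_boot all_order all_algebra.
From mathcomp Require Import all_classical all_reals all_analysis measurable_realfun.
From mathcomp Require Import perm ring lra.
Import Order.TTheory GRing.Theory Num.Theory.
Local Open Scope classical_set_scope.
Local Open Scope ring_scope.
Set Implicit Arguments.
Unset Strict Implicit.
Unset Printing Implicit Defensive.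

(** * The inequalities of Prekopa-Leindler and Brunn-Minkowski *)

(** The first row and column are not coordinates but affine functions of the minor, so exchanging
    two columns is not a permutation of coordinates and its invariance has to be earned. It is
    reduced to one kind of measure-preserving map, [reflect_coord]: a single coordinate is replaced
    by a function of the others minus that coordinate. Translations are two such maps in a row.
    Brunn-Minkowski is needed only for midpoints and in the multiplicative form
    [vol A * vol B <= vol C ^ 2]. This form passes through the induction on the dimension without
    roots, and it bounds the survival function along an arithmetic progression of levels, which is
    all that a Riemann sum sees. Everything lives in the unit cube, which keeps all volumes and
    slices finite. *)

Lemma lebesgue_measure_reflect (R : realType) (g : R) (A : set (measurableTypeR R)) :
  measurable A -> lebesgue_measure [set x | A (g - x)] = lebesgue_measure A.
Proof.
move=> mA.
have mf : measurable_fun [set: measurableTypeR R]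
    (fun x : measurableTypeR R => (g - x : measurableTypeR R)).
  by apply: measurable_funB.
apply/esym.
pose m : {measure set (measurableTypeR R) -> \bar R} :=
  measure_function_pushforward__canonical__measure_function_Measure
    (@lebesgue_measure R) mf.
apply: (@lebesgue_measure_unique R m) => // _ [[a b]] _ <-.
rewrite /m /= /pushforward.
rewrite (_ : _ @^-1` _ = `[g - b, g - a[%classic); last first.
  by apply/seteqP; split=> x /=; rewrite !in_itv/= => /andP[? ?]; apply/andP; split; lra.
rewrite !lebesgue_measure_itv/= !lte_fin ltrD2l ltrN2.
by case: ifPn => // ?; rewrite -!EFinD; congr EFin; ring.
Qed.

(** A translation is the composite of two reflections. *)
Lemma lebesgue_measure_shift (R : realType) (g : R) (A : set (measurableTypeR R)) :
  measurable A -> lebesgue_measure [set x | A (x - g)] = lebesgue_measure A.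
Proof.
move=> mA.
have mB : measurable ([set x | A (- g - x)] : set (measurableTypeR R)).
  rewrite -[X in measurable X]setTI.
  by have : measurable_fun [set: measurableTypeR R]
    (fun x : measurableTypeR R => (- g - x : measurableTypeR R));
    [apply: measurable_funB|apply].
rewrite -(lebesgue_measure_reflect (- g) mA) -(lebesgue_measure_reflect 0 mB).
by congr (lebesgue_measure _); apply/seteqP; split => x /=; rewrite sub0r opprK addrC.
Qed.

Lemma lebesgue_measure_half (R : realType) (A : set (measurableTypeR R)) :
  measurable A -> lebesgue_measure [set x | A (x / 2)] = (2%:E * lebesgue_measure A)%E.
Proof.
move=> mA.
have mf : measurable_fun [set: measurableTypeR R]
    (fun x : measurableTypeR R => (x / 2 : measurableTypeR R)).
  by apply: measurable_funM.
pose m : {measure set (measurableTypeR R) -> \bar R} :=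
  measure_function_pushforward__canonical__measure_function_Measure
    (@lebesgue_measure R) mf.
have half_ge0 : 0 <= 2^-1 :> R by rewrite invr_ge0.
pose m' : {measure set (measurableTypeR R) -> \bar R} := mscale (NngNum half_ge0) m.
have <- : (2%:E * m' A)%E = lebesgue_measure [set x | A (x / 2)].
  by rewrite /m' /= /mscale /m /= /pushforward muleA -EFinM divff// mul1e.
congr (_ * _)%E; apply/esym/(@lebesgue_measure_unique R m') => // _ [[a b]] _ <-.
rewrite /m' /= /mscale /m /= /pushforward.
rewrite (_ : _ @^-1` _ = `]a * 2, b * 2]%classic); last first.
  by apply/seteqP; split=> x /=; rewrite !in_itv/= => /andP[? ?]; apply/andP; split; lra.
rewrite !lebesgue_measure_itv/= !lte_fin ltr_pM2r//.
case: ifPn => // ?; last by rewrite mule0.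
by rewrite -!EFinD -EFinM; congr EFin; field.
Qed.

(** One-dimensional Brunn-Minkowski. With [a] close to [sup A] and [b] close to [inf B], the
    translates [A + b] and [B + a] both lie in [2 C]. The first ends and the second begins within
    [e / 2] of [a + b], so they overlap in measure at most [e]. The [e] is there because the
    supremum and the infimum need not be attained. *)
Lemma lebesgue_midpoint (R : realType) (A B C : set (measurableTypeR R)) :
  measurable A -> measurable B -> measurable C -> A !=set0 -> B !=set0 ->
  A `<=` `[0, 1] -> B `<=` `[0, 1] ->
  (forall x y, A x -> B y -> C ((x + y) / 2)) ->
  (lebesgue_measure A + lebesgue_measure B <= 2%:E * lebesgue_measure C)%E.
Proof.
move=> mA mB mC A0 B0 A01 B01 ABC.
have supA : has_sup A.
  by split => //; exists 1 => x /A01/=; rewrite in_itv/= => /andP[].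
have infB : has_inf B.
  by split => //; exists 0 => x /B01/=; rewrite in_itv/= => /andP[].
apply/lee_addgt0Pr => e e0.
have e20 : 0 < e / 2 by rewrite divr_gt0.
have [a Aa ae] := sup_adherent e20 supA.
have [b Bb be] := inf_adherent e20 infB.
set X : set (measurableTypeR R) := [set x | A (x - b)].
set Y : set (measurableTypeR R) := [set x | B (x - a)].
set D : set (measurableTypeR R) := [set x | C (x / 2)].
have msh c (E : set (measurableTypeR R)) : measurable E ->
    measurable ([set x | E (x - c)] : set (measurableTypeR R)).
  move=> mE; rewrite -[X in measurable X]setTI.
  by have : measurable_fun [set: measurableTypeR R]
    (fun x : measurableTypeR R => (x - c : measurableTypeR R));
    [apply: measurable_funB|apply].
have mX : measurable X by exact: msh.
have mY : measurable Y by exact: msh.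
have mD : measurable D.
  rewrite -[X in measurable X]setTI.
  by have : measurable_fun [set: measurableTypeR R]
    (fun x : measurableTypeR R => (x / 2 : measurableTypeR R));
    [apply: measurable_funM|apply].
rewrite -(lebesgue_measure_shift b mA) -(lebesgue_measure_shift a mB) -/X -/Y.
rewrite -lebesgue_measure_half// -/D.
have XYD : (lebesgue_measure (X `\` Y) + lebesgue_measure Y <= lebesgue_measure D)%E.
  rewrite -measureU//; last 2 first.
  - exact: measurableD.
  - by apply/seteqP; split => // x [[_ nY] /nY].
  apply: le_measure; rewrite ?inE//; first by apply: measurableU => //; exact: measurableD.
  move=> z [[/ABC/(_ Bb)]|/(ABC _ _ Aa)] /=; rewrite /D /= => + _ || (rewrite /D /= => +).
  - by rewrite subrK.
  - by rewrite addrC subrK.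
have XIY : (lebesgue_measure (X `&` Y) <= e%:E)%E.
  have -> : e%:E = lebesgue_measure (`[a + b - e / 2, a + b + e / 2]%classic : set R).
    rewrite lebesgue_measure_itv/= lte_fin ifT -?EFinB; last by lra.
    by congr EFin; field.
  apply: le_measure; rewrite ?inE//; first exact: measurableI.
  move=> z [Xz Yz] /=; rewrite in_itv/=.
  have := sup_upper_bound supA Xz; have := ge_inf infB.2 Yz.
  by move=> ? ?; apply/andP; split; lra.
rewrite [X in (X + _)%E](@measureDI _ _ _ (@lebesgue_measure R) X Y)// addeAC.
exact: leeD.
Qed.

(** The cut at height 1 restricts the levels to [[0, 1[], where the superlevel sets of functions
    with supremum 1 are nonempty. The third function of Prekopa-Leindler may exceed 1 after
    rescaling; the cut only lowers its integral. *)
Definition undergraph (R : realType) (f : measurableTypeR R -> R) :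
    set (measurableTypeR R * measurableTypeR R) :=
  [set p | (0 <= p.2 :> R) && (p.2 < Num.min 1 (f p.1) :> R)].

Lemma measurable_undergraph (R : realType) (f : measurableTypeR R -> R) :
  measurable_fun setT f -> measurable (undergraph f).
Proof.
move=> mf; pose g := fun p : measurableTypeR R * measurableTypeR R =>
  ((0 <= p.2 :> R) && (p.2 < Num.min 1 (f p.1) :> R)).
have m1 : measurable_fun setT
  (fun p : measurableTypeR R * measurableTypeR R => p.1) by exact: measurable_fst.
have m2 : measurable_fun setT
  (fun p : measurableTypeR R * measurableTypeR R => p.2) by exact: measurable_snd.
have mg : measurable_fun setT g.
  apply: measurable_and; first by apply: (measurable_fun_ler _ m2); exact: measurable_cst.
  apply: (measurable_fun_ltr m2); apply: measurable_minr; first exact: measurable_cst.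
  exact: measurableT_comp mf m1.
by have := mg measurableT [set true] I; rewrite setTI.
Qed.

(** Layer-cake formula, by Tonelli for the indicator of the undergraph: its sections at fixed [x]
    are intervals, its sections at fixed height [s] are superlevel sets. *)
Lemma integral_undergraph (R : realType) (f : measurableTypeR R -> R) :
  measurable_fun setT f -> (forall x, 0 <= f x) ->
  (\int[lebesgue_measure]_x (Num.min 1 (f x))%:E =
   \int[lebesgue_measure]_(s in `[0%R, 1%R[)
     lebesgue_measure [set x | (s < f x)%R])%E.
Proof.
move=> mf f0; have mU := measurable_undergraph mf.
have /esym := @indic_fubini_tonelli _ _ _ _ R (@lebesgue_measure R)
  (@lebesgue_measure R) _ mU.
rewrite indic_fubini_tonelli_FE// indic_fubini_tonelli_GE// => E.
transitivity (\int[lebesgue_measure]_x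
    (lebesgue_measure \o xsection (undergraph f)) x)%E.
  apply: eq_integral => x _ /=.
  rewrite (_ : xsection _ _ = `[0%R, Num.min 1 (f x)[%classic); last first.
    apply/seteqP; split=> y; first by move=> /xsectionP; rewrite /undergraph /= in_itv.
    by rewrite /= in_itv => yf; apply/xsectionP.
  rewrite lebesgue_measure_itv/= lte_fin -EFinD subr0.
  case: ifPn => //; rewrite -leNgt => m0; congr EFin; apply/eqP.
  by rewrite eq_le m0 le_min ler01 f0.
rewrite -E [RHS]integral_mkcond; apply: eq_integral => s _ /=.
rewrite patchE; case: ifPn => [|]; rewrite ?notin_setE ?inE /= in_itv/= => s01.
  congr lebesgue_measure; apply/seteqP; split => y.
    by move=> /ysectionP /andP[_]; rewrite lt_min => /andP[].
  move=> /= sf; apply/ysectionP; rewrite /undergraph /=.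
  by case/andP: s01 => -> s1; rewrite lt_min s1.
rewrite (_ : ysection _ _ = set0) ?measure0//.
apply/seteqP; split => y // /ysectionP; rewrite /undergraph /= lt_min.
by move/negP: s01 => + /andP[s0 /andP[s1 _]]; rewrite s0 s1.
Qed.

Lemma measurable_superlevel_measure (R : realType) (f : measurableTypeR R -> R) :
  measurable_fun setT f -> (forall x, 0 <= f x) ->
  measurable_fun (`[0, 1[%classic : set (measurableTypeR R))
    (fun s : measurableTypeR R => lebesgue_measure [set x | (s < f x)%R]).
Proof.
move=> mf f0; have mU := measurable_undergraph mf.
have := measurable_fun_ysection (@lebesgue_measure R) mU.
move=> /(@measurable_funTS _ _ _ _ (`[0, 1[%classic : set (measurableTypeR R))).
apply: eq_measurable_fun => s /[!inE]/=; rewrite in_itv/= => s01.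
congr lebesgue_measure; apply/seteqP; split => y.
  by move=> /ysectionP /andP[_]; rewrite lt_min => /andP[].
move=> /= sf; apply/ysectionP; rewrite /undergraph /=.
by case/andP: s01 => -> s1; rewrite lt_min s1.
Qed.

(** If [f x] and [g y] exceed [s], the hypothesis puts [h] above [s] at the midpoint, so
    [lebesgue_midpoint] applies level by level and the bound is integrated over [s]. Supremum 1 for
    both functions makes the two superlevel sets nonempty at the same levels, as the one-dimensional
    inequality requires. *)
Lemma prekopa_leindler_sup1 (R : realType) (f g h : measurableTypeR R -> R) :
  measurable_fun setT f -> measurable_fun setT g -> measurable_fun setT h ->
  (forall x, 0 <= f x <= 1) -> (forall x, 0 <= g x <= 1) -> (forall x, 0 <= h x) ->
  (forall x, f x != 0 -> 0 <= x <= 1) -> (forall x, g x != 0 -> 0 <= x <= 1) ->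
  (forall s, s < 1 -> exists x, s < f x) -> (forall s, s < 1 -> exists x, s < g x) ->
  (forall x y, f x * g y <= h ((x + y) / 2) ^+ 2) ->
  (\int[lebesgue_measure]_x (f x)%:E + \int[lebesgue_measure]_x (g x)%:E <=
   2%:E * \int[lebesgue_measure]_x (h x)%:E)%E.
Proof.
move=> mf mg mh f01 g01 h0 fs gs fsup gsup fgh.
have f0 x : 0 <= f x by case/andP: (f01 x).
have g0 x : 0 <= g x by case/andP: (g01 x).
have -> : (\int[lebesgue_measure]_x (f x)%:E =
    \int[lebesgue_measure]_x (Num.min 1 (f x))%:E)%E.
  apply: eq_integral => x _; congr EFin; apply/esym/min_idPr.
  by case/andP: (f01 x).
have -> : (\int[lebesgue_measure]_x (g x)%:E =
    \int[lebesgue_measure]_x (Num.min 1 (g x))%:E)%E.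
  apply: eq_integral => x _; congr EFin; apply/esym/min_idPr.
  by case/andP: (g01 x).
apply: (@le_trans _ _ (2%:E * \int[lebesgue_measure]_x (Num.min 1 (h x))%:E)%E); last first.
  apply: lee_wpmul2l => //; apply: ge0_le_integral => //.
  - by move=> x _; rewrite lee_fin le_min ler01 h0.
  - by apply/measurable_EFinP; exact: measurable_minr.
  - by apply/measurable_EFinP.
  - by move=> x _; rewrite lee_fin ge_min lexx orbT.
rewrite !integral_undergraph//.
have mI : measurable (`[0, 1[%classic : set (measurableTypeR R)) by [].
have mF := measurable_superlevel_measure mf f0.
have mG := measurable_superlevel_measure mg g0.
have mH := measurable_superlevel_measure mh h0.
rewrite -ge0_integralD// -ge0_integralZl//.
apply: ge0_le_integral => //.
- by move=> s _; apply: adde_ge0.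
- exact: emeasurable_funD.
- exact: measurable_funeM.
move=> s /=; rewrite in_itv/= => /andP[s0 s1].
have mlev (u : measurableTypeR R -> R) : measurable_fun setT u ->
    measurable [set x | s < u x].
  move=> mu; have mv : measurable_fun setT (fun x : measurableTypeR R => s < u x).
    exact: measurable_fun_ltr.
  by have := mv measurableT [set true] I; rewrite setTI.
apply: lebesgue_midpoint; [exact: mlev|exact: mlev|exact: mlev|exact: fsup|exact: gsup| | |].
- by move=> x /= sf; rewrite in_itv/=; apply: fs; rewrite gt_eqF// (le_lt_trans s0).
- by move=> x /= sf; rewrite in_itv/=; apply: gs; rewrite gt_eqF// (le_lt_trans s0).
move=> x y /= sf sg; rewrite -(@ltr_pXn2r _ 2)// ?nnegrE//.
by apply: lt_le_trans (fgh x y); rewrite expr2 ltr_pM.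
Qed.

(** The case of exponent 1/2, squared to avoid roots. Values and supports in [[0, 1]] make the
    integrals finite, and slice volumes of subsets of the cube satisfy both conditions. *)
Lemma prekopa_leindler (R : realType) (f g h : measurableTypeR R -> R) :
  measurable_fun setT f -> measurable_fun setT g -> measurable_fun setT h ->
  (forall x, 0 <= f x <= 1) -> (forall x, 0 <= g x <= 1) -> (forall x, 0 <= h x <= 1) ->
  (forall x, f x != 0 -> 0 <= x <= 1) -> (forall x, g x != 0 -> 0 <= x <= 1) ->
  (forall x, h x != 0 -> 0 <= x <= 1) ->
  (forall x y, f x * g y <= h ((x + y) / 2) ^+ 2) ->
  (\int[lebesgue_measure]_x (f x)%:E * \int[lebesgue_measure]_x (g x)%:E <=
   \int[lebesgue_measure]_x (h x)%:E * \int[lebesgue_measure]_x (h x)%:E)%E.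
Proof.
move=> mf mg mh f01 g01 h01 fs gs hs fgh.
have int0 (u : measurableTypeR R -> R) : (forall x, 0 <= u x <= 1) ->
    (0 <= \int[lebesgue_measure]_x (u x)%:E)%E.
  by move=> u01; apply: integral_ge0 => x _; rewrite lee_fin; case/andP: (u01 x).
have int1 (u : measurableTypeR R -> R) : measurable_fun setT u ->
    (forall x, 0 <= u x <= 1) -> (forall x, u x != 0 -> 0 <= x <= 1) ->
    (\int[lebesgue_measure]_x (u x)%:E)%E \is a fin_num.
  move=> mu u01 us; rewrite ge0_fin_numE ?int0//.
  apply: le_lt_trans (ltry 1).
  have mI : measurable (`[0, 1]%classic : set (measurableTypeR R)) by exact: measurable_itv.
  have -> : (1 = \int[lebesgue_measure]_x
      (\1_(`[0, 1]%classic : set (measurableTypeR R)) x)%:E)%E.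
    rewrite integral_indic// setIT.
    have := @lebesgue_measure_itv R `[0, 1].
    by rewrite /= lte_fin ltr01 -EFinD subr0 => ->.
  apply: ge0_le_integral => //.
  - by move=> x _; rewrite lee_fin; case/andP: (u01 x).
  - exact/measurable_EFinP.
  - by apply/measurable_EFinP; exact: measurable_indic.
  move=> x _; rewrite lee_fin indicE.
  have [u0|/us x01] := eqVneq (u x) 0; first by rewrite u0.
  by rewrite mem_set /= ?in_itv//; case/andP: (u01 x).
(* A function that is not identically zero is rescaled to have supremum 1. *)
have sup_pos (u : measurableTypeR R -> R) : (forall x, 0 <= u x <= 1) ->
    (forall x, u x = 0) \/ exists2 M, 0 < M & ((forall x, u x <= M) /\
      forall s, s < M -> exists x, s < u x).
  move=> u01; have [[x ux]|u0] := pselect (exists x, u x != 0); last first.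
    by left=> x; apply/eqP/negPn/negP => ux; apply: u0; exists x.
  right; have su : has_sup (range u).
    by split; [exists (u x), x|exists 1 => _ [y _ <-]; case/andP: (u01 y)].
  have leM y : u y <= sup (range u) by apply: (sup_upper_bound su); exists y.
  exists (sup (range u)).
    by apply: lt_le_trans (leM x); rewrite lt0r ux; case/andP: (u01 x).
  split=> // s sM; have e0 : 0 < sup (range u) - s by rewrite subr_gt0.
  by have [_ [y _ <-]] := sup_adherent e0 su; rewrite subKr; exists y.
have [f0|[M M0 [fM Msup]]] := sup_pos f f01.
  rewrite [X in (X * _)%E]integral0_eq ?mul0e; last by move=> x _; rewrite f0.
  by apply: mule_ge0; exact: int0.
have [g0|[N N0 [gN Nsup]]] := sup_pos g g01.
  rewrite [X in (_ * X)%E]integral0_eq ?mule0; last by move=> x _; rewrite g0.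
  by apply: mule_ge0; exact: int0.
(* Dividing [h] by the geometric mean of the two suprema preserves [f x * g y <= h ^ 2] when [f] and
   [g] are divided by [M] and [N]. *)
set c := Num.sqrt (M * N).
have c0 : 0 < c by rewrite sqrtr_gt0 mulr_gt0.
have c2 : c ^+ 2 = M * N by rewrite sqr_sqrtr// mulr_ge0// ltW.
have scaled (u : measurableTypeR R -> R) k : 0 < k -> measurable_fun setT u ->
    (forall x, 0 <= u x <= 1) -> (\int[lebesgue_measure]_x (k^-1 * u x)%:E =
    k^-1%:E * \int[lebesgue_measure]_x (u x)%:E)%E.
  move=> k0 mu u01; rewrite -ge0_integralZl_EFin//.
  - by move=> x _; rewrite lee_fin; case/andP: (u01 x).
  - exact/measurable_EFinP.
  - by rewrite invr_ge0 ltW.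
have mscaled (u : measurableTypeR R -> R) k : measurable_fun setT u ->
  measurable_fun setT (fun x => k^-1 * u x) by move=> mu; exact: measurable_funM.
have := @prekopa_leindler_sup1 R (fun x => M^-1 * f x) (fun x => N^-1 * g x)
  (fun x => c^-1 * h x) (mscaled _ _ mf) (mscaled _ _ mg) (mscaled _ _ mh).
have f1 x : 0 <= M^-1 * f x <= 1.
  rewrite mulr_ge0 ?invr_ge0 ?(ltW M0)//=; last by case/andP: (f01 x).
  by rewrite mulrC ler_pdivrMr// mul1r.
have g1 x : 0 <= N^-1 * g x <= 1.
  rewrite mulr_ge0 ?invr_ge0 ?(ltW N0)//=; last by case/andP: (g01 x).
  by rewrite mulrC ler_pdivrMr// mul1r.
have h0 x : 0 <= c^-1 * h x.
  by rewrite mulr_ge0 ?invr_ge0 ?(ltW c0)//; case/andP: (h01 x).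
have fs1 x : M^-1 * f x != 0 -> 0 <= x <= 1.
  by rewrite mulf_eq0 negb_or => /andP[_ /fs].
have gs1 x : N^-1 * g x != 0 -> 0 <= x <= 1.
  by rewrite mulf_eq0 negb_or => /andP[_ /gs].
have fsup s : s < 1 -> exists x, s < M^-1 * f x.
  move=> s1; have /Msup[x sx] : s * M < M by rewrite gtr_pMl.
  by exists x; rewrite mulrC ltr_pdivlMr.
have gsup s : s < 1 -> exists x, s < N^-1 * g x.
  move=> s1; have /Nsup[x sx] : s * N < N by rewrite gtr_pMl.
  by exists x; rewrite mulrC ltr_pdivlMr.
have fgh1 x y : M^-1 * f x * (N^-1 * g y) <= (c^-1 * h ((x + y) / 2)) ^+ 2.
  rewrite exprMn exprVn c2 invfM mulrACA ler_pM2l//.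
  by rewrite mulr_gt0// invr_gt0.
move=> /(_ f1 g1 h0 fs1 gs1 fsup gsup fgh1).
rewrite !scaled// -(fineK (int1 _ mf f01 fs)) -(fineK (int1 _ mg g01 gs)).
rewrite -(fineK (int1 _ mh h01 hs)) -!EFinM -EFinD !lee_fin.
set F := fine _; set G := fine _; set H := fine _ => FGH.
have F0 : 0 <= F by rewrite fine_ge0// int0.
have G0 : 0 <= G by rewrite fine_ge0// int0.
rewrite -(@ler_pM2l _ ((M * N)^-1)); last by rewrite invr_gt0 mulr_gt0.
have -> : (M * N)^-1 * (F * G) = (M^-1 * F) * (N^-1 * G) by rewrite invfM mulrACA.
have -> : (M * N)^-1 * (H * H) = (c^-1 * H) * (c^-1 * H).
  by rewrite -c2 expr2 invfM mulrACA.
have : 0 <= M^-1 * F by rewrite mulr_ge0// invr_ge0 ltW.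
have : 0 <= N^-1 * G by rewrite mulr_ge0// invr_ge0 ltW.
move: FGH; move: (M^-1 * F) (N^-1 * G) (c^-1 * H) => p q r pq q0 p0.
(* AM-GM: pq <= ((p + q) / 2)^2 <= r^2 *)
have : 0 <= (p - q) ^+ 2 by exact: sqr_ge0.
have : (p + q) ^+ 2 <= (2 * r) ^+ 2 by rewrite ler_sqr// nnegrE; lra.
by rewrite !expr2; nra.
Qed.

(** * Slicing Lebesgue measure on tuples, and Brunn-Minkowski in the cube *)

Definition unit_cube (R : realType) n : set (n.-tuple (measurableTypeR R)) :=
  [set t | forall i, 0 <= tnth t i <= 1].

Definition midpoint (R : realType) n (s t : n.-tuple (measurableTypeR R)) :
    n.-tuple (measurableTypeR R) :=
  [tuple (tnth s i + tnth t i) / 2 | i < n].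

Lemma lebesgue_tupleS (R : realType) n (A : set (n.+1.-tuple (measurableTypeR R))) :
  lebesgue_tuple A = (\int[lebesgue_measure]_x
    lebesgue_tuple [set t : n.-tuple (measurableTypeR R) | A (Defs.cons_tuple (x, t))])%E.
Proof.
rewrite {1}/lebesgue_tuple /= /cons_measure /pushforward /product_measure1.
apply: eq_integral => x _ /=; congr (power_measure _ _).
by apply/seteqP; split=> t; [move/xsectionP|move=> At; apply/xsectionP].
Qed.

Lemma measurable_cons_section (R : realType) n
    (A : set (n.+1.-tuple (measurableTypeR R))) x :
  measurable A ->
  measurable [set t : n.-tuple (measurableTypeR R) | A (Defs.cons_tuple (x, t))].
Proof.
move=> mA.
have mA' : measurable (@Defs.cons_tuple _ (measurableTypeR R) n @^-1` A).
  by rewrite -[X in measurable X]setTI; exact: Defs.measurable_cons_tuple.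
have := measurable_xsection x mA'; congr (measurable _).
by apply/seteqP; split=> t; [move/xsectionP|move=> At; apply/xsectionP].
Qed.

Lemma measurable_cons_slice (R : realType) n
    (A : set (n.+1.-tuple (measurableTypeR R))) :
  measurable A -> measurable_fun [set: measurableTypeR R] (fun x =>
    lebesgue_tuple [set t : n.-tuple (measurableTypeR R) | A (Defs.cons_tuple (x, t))]).
Proof.
move=> mA.
have mA' : measurable (@Defs.cons_tuple _ (measurableTypeR R) n @^-1` A).
  by rewrite -[X in measurable X]setTI; exact: Defs.measurable_cons_tuple.
have := measurable_fun_xsection (@lebesgue_tuple R n) mA'.
apply: eq_measurable_fun => x _ /=; congr (lebesgue_tuple _).
by apply/seteqP; split=> t; [move/xsectionP|move=> At; apply/xsectionP].
Qed.

Lemma measurable_box (R : realType) n (a b : 'I_n -> R) :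
  measurable [set t : n.-tuple (measurableTypeR R) | forall i, a i <= tnth t i <= b i].
Proof.
rewrite (_ : [set t | _] = \bigcap_(i in [set: 'I_n])
    ((@tnth n (measurableTypeR R) ^~ i) @^-1` `[a i, b i]%classic)); last first.
  apply/seteqP; split => t /= h i; first by move=> _; rewrite /= in_itv; exact: h.
  by have := h i I; rewrite /= in_itv.
apply: fin_bigcap_measurable => // i _; rewrite -[X in measurable X]setTI.
exact: measurable_tnth.
Qed.

Lemma measurable_unit_cube (R : realType) n : measurable (@unit_cube R n).
Proof. exact: measurable_box. Qed.

Lemma lebesgue_tuple_unit_cube (R : realType) n (A : set (n.-tuple (measurableTypeR R))) :
  measurable A -> A `<=` @unit_cube R n -> (lebesgue_tuple A <= 1)%E.
Proof.
move=> mA Asub; have -> : (1 = lebesgue_tuple (@unit_cube R n))%E.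
  rewrite lebesgue_tuple_box; last by move=> i; exact: ler01.
  by rewrite big1// => i _; rewrite subr0.
by apply: le_measure => //; rewrite inE//; exact: measurable_unit_cube.
Qed.

(** Induction on the dimension: the induction hypothesis, applied to slices over [x], [y] and their
    midpoint, is exactly the hypothesis of [prekopa_leindler] for the functions giving the volumes
    of the slices. *)
Lemma brunn_minkowski (R : realType) n (A B C : set (n.-tuple (measurableTypeR R))) :
  measurable A -> measurable B -> measurable C ->
  A `<=` @unit_cube R n -> B `<=` @unit_cube R n -> C `<=` @unit_cube R n ->
  (forall s t, A s -> B t -> C (midpoint s t)) ->
  (lebesgue_tuple A * lebesgue_tuple B <= lebesgue_tuple C * lebesgue_tuple C)%E.
Proof.
elim: n => [|n IH] in A B C *.
  move=> mA mB mC _ _ _ ABC; rewrite /lebesgue_tuple /= /dirac !indicE.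
  have [At|_] := boolP ([tuple] \in A); last by rewrite mul0e -EFinM lee_fin mulr_ge0.
  have [Bt|_] := boolP ([tuple] \in B); last by rewrite mule0 -EFinM lee_fin mulr_ge0.
  have /ABC/(_ (set_mem Bt)) := set_mem At.
  by rewrite (tuple0 (midpoint _ _)) => /mem_set ->.
move=> mA mB mC Asub Bsub Csub ABC.
pose sec (D : set (n.+1.-tuple (measurableTypeR R))) x :=
  [set t : n.-tuple (measurableTypeR R) | D (Defs.cons_tuple (x, t))].
have sec_cube (D : set (n.+1.-tuple (measurableTypeR R))) x :
    D `<=` @unit_cube R n.+1 -> sec D x `<=` @unit_cube R n.
  by move=> DS t /DS tc i; have := tc (lift ord0 i); rewrite tnthS.
pose F D x := fine (lebesgue_tuple (sec D x)).
have F_fin D x : measurable D -> D `<=` @unit_cube R n.+1 ->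
    lebesgue_tuple (sec D x) = (F D x)%:E.
  move=> mD Dsub; rewrite fineK// ge0_fin_numE//.
  apply: le_lt_trans (ltry 1); apply: lebesgue_tuple_unit_cube; last exact: sec_cube.
  exact: measurable_cons_section.
have intF D : measurable D -> D `<=` @unit_cube R n.+1 ->
    lebesgue_tuple D = (\int[lebesgue_measure]_x (F D x)%:E)%E.
  move=> mD Dsub; rewrite lebesgue_tupleS; apply: eq_integral => x _.
  exact: F_fin.
have mF D : measurable D -> D `<=` @unit_cube R n.+1 -> measurable_fun setT (F D).
  move=> mD Dsub; apply/measurable_EFinP.
  apply: eq_measurable_fun (measurable_cons_slice mD) => x _ /=.
  exact: F_fin.
have F01 D x : measurable D -> D `<=` @unit_cube R n.+1 -> 0 <= F D x <= 1.
  move=> mD Dsub; rewrite fine_ge0//= -lee_fin -F_fin//.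
  apply: lebesgue_tuple_unit_cube; last exact: sec_cube.
  exact: measurable_cons_section.
have Fs D x : D `<=` @unit_cube R n.+1 -> F D x != 0 -> 0 <= x <= 1.
  move=> Dsub; have [[t Dt] _|D0] := pselect (sec D x !=set0).
    by have := Dsub _ Dt ord0.
  rewrite /F (_ : sec D x = set0) ?measure0 ?eqxx//.
  by apply/seteqP; split=> // t Dt; apply: D0; exists t.
rewrite !intF//; apply: prekopa_leindler.
- exact: mF.
- exact: mF.
- exact: mF.
- by move=> x; exact: F01.
- by move=> x; exact: F01.
- by move=> x; exact: F01.
- by move=> x; exact: Fs.
- by move=> x; exact: Fs.
- by move=> x; exact: Fs.
move=> x y; rewrite -lee_fin expr2 !EFinM -!F_fin//.
apply: IH; [exact: measurable_cons_section|exact: measurable_cons_section|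
  exact: measurable_cons_section|exact: sec_cube|exact: sec_cube|exact: sec_cube|].
move=> s t /= As Bt; have := ABC _ _ As Bt; congr C.
apply/eq_from_tnth => i; rewrite tnth_mktuple.
have [->|] := eqVneq i ord0; first by rewrite !tnth0.
by rewrite eq_sym => /unlift_some[j -> _]; rewrite !tnthS tnth_mktuple.
Qed.

(** * Reflections of a single coordinate *)

(** Integrates the first coordinate innermost, unlike [lebesgue_tupleS]: a reflection of this
    coordinate whose centre depends on the others is measure preserving once they are fixed. *)
Lemma lebesgue_tupleS_ysection (R : realType) n
    (A : set (n.+1.-tuple (measurableTypeR R))) :
  measurable A ->
  lebesgue_tuple A = (\int[@lebesgue_tuple R n]_t
    lebesgue_measure [set x : measurableTypeR R | A (Defs.cons_tuple (x, t))])%E.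
Proof.
move=> mA.
have mA' : measurable (@Defs.cons_tuple _ (measurableTypeR R) n @^-1` A).
  by rewrite -[X in measurable X]setTI; exact: Defs.measurable_cons_tuple.
have := indic_fubini_tonelli (@lebesgue_measure R) (@lebesgue_tuple R n) mA'.
rewrite indic_fubini_tonelli_FE// indic_fubini_tonelli_GE// => E.
rewrite lebesgue_tupleS; transitivity (\int[lebesgue_measure]_x
  (@lebesgue_tuple R n \o xsection (@Defs.cons_tuple _ (measurableTypeR R) n @^-1` A)) x)%E.
  apply: eq_integral => x _ /=; congr lebesgue_tuple.
  by apply/seteqP; split=> t; [move=> At; apply/xsectionP|move/xsectionP].
rewrite E; apply: eq_integral => t _ /=; congr lebesgue_measure.
by apply/seteqP; split=> x; [move/ysectionP|move=> At; apply/ysectionP].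
Qed.

Definition reflect_coord (R : realType) n (k : 'I_n)
    (g : n.-tuple (measurableTypeR R) -> R) (t : n.-tuple (measurableTypeR R)) :
    n.-tuple (measurableTypeR R) :=
  [tuple if i == k then g t - tnth t k else tnth t i | i < n].

Lemma measurable_reflect_coord (R : realType) n (k : 'I_n)
    (g : n.-tuple (measurableTypeR R) -> R) :
  measurable_fun setT g -> measurable_fun setT (reflect_coord k g).
Proof.
move=> mg; apply/measurable_fun_tnthP => i.
have -> : @tnth n (measurableTypeR R) ^~ i \o reflect_coord k g =
    fun t => if i == k then g t - tnth t k else tnth t i.
  by apply/funext => t /=; rewrite tnth_mktuple.
case: eqVneq => _; last exact: measurable_tnth.
by apply: measurable_funB => //; exact: measurable_tnth.
Qed.

(** Coordinates before [k] are peeled off by induction, becoming parameters of [g]. When [k] comes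
    first, the map is a one-dimensional reflection for each value of the remaining coordinates. *)
Lemma lebesgue_tuple_reflect_coord (R : realType) n (k : 'I_n)
    (g : n.-tuple (measurableTypeR R) -> R) (A : set (n.-tuple (measurableTypeR R))) :
  measurable_fun setT g ->
  (forall s t, (forall i, i != k -> tnth s i = tnth t i) -> g s = g t) ->
  measurable A ->
  lebesgue_tuple [set t | A (reflect_coord k g t)] = lebesgue_tuple A.
Proof.
elim: n => [|n IH] in k g A *; first by case: k.
move=> mg gk mA.
have mT := measurable_reflect_coord k mg.
have mB : measurable [set t | A (reflect_coord k g t)].
  by have := mT measurableT A mA; rewrite setTI.
have mcons x : measurable_fun setT
    (fun t : n.-tuple (measurableTypeR R) => Defs.cons_tuple (x, t)).
  by apply: measurableT_comp; [exact: Defs.measurable_cons_tuple|exact: pair1_measurable].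
have [k0|k0] := eqVneq k ord0.
  rewrite !lebesgue_tupleS_ysection//; apply: eq_integral => t _.
  have mAt : measurable [set x : measurableTypeR R | A (Defs.cons_tuple (x, t))].
    have mpair : measurable_fun setT
      (fun x : measurableTypeR R => Defs.cons_tuple (x, t)).
      by apply: measurableT_comp; [exact: Defs.measurable_cons_tuple|exact: pair2_measurable].
    by have := mpair measurableT A mA; rewrite setTI.
  (* The value [0] in place of coordinate [k] is arbitrary, since [gk] says that [g] ignores this
     coordinate. *)
  rewrite -[RHS](lebesgue_measure_reflect (g (Defs.cons_tuple (0 : measurableTypeR R, t))) mAt).
  have E x : reflect_coord k g (Defs.cons_tuple (x, t)) =
      Defs.cons_tuple (g (Defs.cons_tuple (0 : measurableTypeR R, t)) - x, t).
    apply/eq_from_tnth => i; rewrite tnth_mktuple k0.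
    have [->|] := eqVneq i ord0.
      rewrite !tnth0; congr (_ - _); apply: gk => j; rewrite k0 eq_sym.
      by move=> /unlift_some[l -> _]; rewrite !tnthS.
    by rewrite eq_sym => /unlift_some[l -> _]; rewrite !tnthS.
  by congr lebesgue_measure; apply/seteqP; split=> x /=; rewrite E.
have [j kj _] : exists2 j, k = lift ord0 j & unlift ord0 k = Some j.
  by move: k0; rewrite eq_sym => /unlift_some[j -> ?]; exists j.
rewrite !lebesgue_tupleS; apply: eq_integral => x _.
rewrite -[RHS](IH j (fun t => g (Defs.cons_tuple (x, t)))).
- have E t : reflect_coord k g (Defs.cons_tuple (x, t)) = Defs.cons_tuple
      (x, reflect_coord j (fun t => g (Defs.cons_tuple (x, t))) t).
    apply/eq_from_tnth => i; rewrite tnth_mktuple kj.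
    have [->|] := eqVneq i ord0; first by rewrite !tnth0.
    rewrite eq_sym => /unlift_some[l -> _].
    by rewrite (inj_eq (@lift_inj _ _)) !tnthS tnth_mktuple.
  by congr lebesgue_tuple; apply/seteqP; split=> t /=; rewrite E.
- exact: measurableT_comp.
- move=> s t st; apply: gk => i ik.
  have [->|] := eqVneq i ord0; first by rewrite !tnth0.
  rewrite eq_sym => /unlift_some[l il _]; rewrite il !tnthS; apply: st.
  by apply: contra ik => /eqP lj; rewrite il kj lj.
- exact: measurable_cons_section.
Qed.

(** * The Birkhoff polytope in minor coordinates *)

Section fill.
Context {R : realType}.
Implicit Types (n : nat).

Definition tuple_mx n (t : (n * n).-tuple (measurableTypeR R)) : 'M[R]_n :=
  \matrix_(i, j) tnth t (mxvec_index i j).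

Definition mx_tuple n (X : 'M[R]_n) : (n * n).-tuple (measurableTypeR R) :=
  [tuple mxvec X ord0 k | k < n * n].

Lemma mx_tupleE n (X : 'M[R]_n) i j : tnth (mx_tuple X) (mxvec_index i j) = X i j.
Proof. by rewrite tnth_mktuple mxvecE. Qed.

Lemma tuple_mxE n (t : (n * n).-tuple (measurableTypeR R)) i j :
  tuple_mx t i j = tnth t (mxvec_index i j).
Proof. by rewrite mxE. Qed.

Lemma mx_tupleK n : cancel (@mx_tuple n) (@tuple_mx n).
Proof. by move=> X; apply/matrixP => i j; rewrite tuple_mxE mx_tupleE. Qed.

Lemma tuple_mxK n : cancel (@tuple_mx n) (@mx_tuple n).
Proof.
move=> t; apply/eq_from_tnth => k; case/mxvec_indexP: k => i j.
by rewrite mx_tupleE tuple_mxE.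
Qed.

Definition complete_mx n (Y : 'M[R]_n) : 'M[R]_n.+1 :=
  \matrix_(i, j) match unlift ord0 i, unlift ord0 j with
    | Some i', Some j' => Y i' j'
    | Some i', None => 1 - \sum_l Y i' l
    | None, Some j' => 1 - \sum_l Y l j'
    | None, None => 1 - \sum_j' (1 - \sum_l Y l j')
  end.

Lemma complete_mxSS n (Y : 'M[R]_n) i j :
  complete_mx Y (lift ord0 i) (lift ord0 j) = Y i j.
Proof. by rewrite mxE !liftK. Qed.

Lemma complete_mxS0 n (Y : 'M[R]_n) i :
  complete_mx Y (lift ord0 i) ord0 = 1 - \sum_l Y i l.
Proof. by rewrite mxE liftK unlift_none. Qed.

Lemma complete_mx0S n (Y : 'M[R]_n) j :
  complete_mx Y ord0 (lift ord0 j) = 1 - \sum_l Y l j.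
Proof. by rewrite mxE liftK unlift_none. Qed.

Lemma complete_mx00 n (Y : 'M[R]_n) :
  complete_mx Y ord0 ord0 = 1 - \sum_j (1 - \sum_l Y l j).
Proof. by rewrite mxE unlift_none. Qed.

Lemma complete_mx_row n (Y : 'M[R]_n) i : \sum_j complete_mx Y i j = 1.
Proof.
rewrite big_ord_recl; have [k ->|->] := unliftP ord0 i.
  rewrite complete_mxS0; under [X in _ + X]eq_bigr do rewrite complete_mxSS.
  by rewrite subrK.
rewrite complete_mx00; under [X in _ + X]eq_bigr do rewrite complete_mx0S.
by rewrite subrK.
Qed.

(** Only the first column needs an argument: the corner was defined from the first row, and
    exchanging the double sum shows that the first column would give the same value. *)
Lemma complete_mx_col n (Y : 'M[R]_n) j : \sum_i complete_mx Y i j = 1.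
Proof.
rewrite big_ord_recl; have [k ->|->] := unliftP ord0 j.
  rewrite complete_mx0S; under [X in _ + X]eq_bigr do rewrite complete_mxSS.
  by rewrite subrK.
rewrite complete_mx00; under [X in _ + X]eq_bigr do rewrite complete_mxS0.
by rewrite !sumrB exchange_big /= subrK.
Qed.

Lemma minorE n (X : 'M[R]_n.+1) i j :
  row' ord0 (col' ord0 X) i j = X (lift ord0 i) (lift ord0 j).
Proof. by rewrite !mxE. Qed.

Lemma complete_minor n (X : 'M[R]_n.+1) :
  (forall i, \sum_j X i j = 1) -> (forall j, \sum_i X i j = 1) ->
  complete_mx (row' ord0 (col' ord0 X)) = X.
Proof.
move=> rX cX; set Y := row' _ _.
have YE i j : Y i j = X (lift ord0 i) (lift ord0 j) by exact: minorE.
have E0S j : 1 - \sum_l Y l j = X ord0 (lift ord0 j).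
  rewrite -(cX (lift ord0 j)) big_ord_recl; under [X in _ - X]eq_bigr do rewrite YE.
  by rewrite addrK.
apply/matrixP => i j.
have [k ->|->] := unliftP ord0 i; have [l ->|->] := unliftP ord0 j.
- by rewrite complete_mxSS YE.
- rewrite complete_mxS0 -(rX (lift ord0 k)) big_ord_recl.
  by under [X in _ - X]eq_bigr do rewrite YE; rewrite addrK.
- by rewrite complete_mx0S E0S.
- rewrite complete_mx00; under [X in _ - X]eq_bigr do rewrite E0S.
  by rewrite -(rX ord0) big_ord_recl addrK.
Qed.

(** Defined for every tuple and always with line sums 1, so that membership in the polytope is a
    matter of signs only. *)
Definition ds_of n (t : (n * n).-tuple (measurableTypeR R)) : 'M[R]_n.+1 :=
  complete_mx (tuple_mx t).

Lemma minor_coords_mx_tuple n (X : 'M[R]_n.+1) :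
  minor_coords X = mx_tuple (row' ord0 (col' ord0 X)).
Proof. by []. Qed.

Lemma ds_ofK n : cancel (@ds_of n) (@minor_coords R n).
Proof.
move=> t; rewrite minor_coords_mx_tuple -[RHS]tuple_mxK; congr mx_tuple.
by apply/matrixP => i j; rewrite minorE complete_mxSS.
Qed.

Lemma minor_coordsK n (X : 'M[R]_n.+1) :
  (forall i, \sum_j X i j = 1) -> (forall j, \sum_i X i j = 1) ->
  ds_of (minor_coords X) = X.
Proof. by move=> rX cX; rewrite /ds_of minor_coords_mx_tuple mx_tupleK complete_minor. Qed.

Definition birkhoff n : set ((n * n).-tuple (measurableTypeR R)) :=
  [set t | forall i j, 0 <= ds_of t i j].

(** Turns the images in [uniform_ds] into preimages under [ds_of], whose measurability is
    accessible. *)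
Lemma minor_coords_image n (E : set 'M[R]_n.+1) :
  @minor_coords R n @` (@doubly_stochastic R n.+1 `&` E) =
  @birkhoff n `&` [set t | E (ds_of t)].
Proof.
apply/seteqP; split=> [_ [X [[X0 rX cX] EX] <-]|t [t0 Et]].
  by split; rewrite /= ?minor_coordsK// => i j; rewrite minor_coordsK.
exists (ds_of t); last exact: ds_ofK.
split=> //; split=> //; [exact: complete_mx_row|exact: complete_mx_col].
Qed.

Lemma measurable_ds_of n i j :
  measurable_fun setT (fun t : (n * n).-tuple (measurableTypeR R) => ds_of t i j).
Proof.
have mt k l : measurable_fun setT
    (fun t : (n * n).-tuple (measurableTypeR R) => tuple_mx t k l).
  by under eq_fun do rewrite tuple_mxE; exact: measurable_tnth.
have mr k : measurable_fun setT
    (fun t : (n * n).-tuple (measurableTypeR R) => 1 - \sum_l tuple_mx t k l).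
  apply: measurable_funB; first exact: measurable_cst.
  by apply: measurable_sum => l; exact: mt.
have mc l : measurable_fun setT
    (fun t : (n * n).-tuple (measurableTypeR R) => 1 - \sum_k tuple_mx t k l).
  apply: measurable_funB; first exact: measurable_cst.
  by apply: measurable_sum => k; exact: mt.
have [k ->|->] := unliftP ord0 i; have [l ->|->] := unliftP ord0 j.
- by under eq_fun do rewrite /ds_of complete_mxSS; exact: mt.
- by under eq_fun do rewrite /ds_of complete_mxS0; exact: mr.
- by under eq_fun do rewrite /ds_of complete_mx0S; exact: mc.
- under eq_fun do rewrite /ds_of complete_mx00.
  apply: measurable_funB; first exact: measurable_cst.
  by apply: measurable_sum => l; exact: mc.
Qed.

Lemma measurable_birkhoff n : measurable (@birkhoff n).
Proof.
have -> : @birkhoff n = \bigcap_(p in [set: 'I_n.+1 * 'I_n.+1])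
    [set t : (n * n).-tuple (measurableTypeR R) | 0 <= ds_of t p.1 p.2].
  by apply/seteqP; split=> [t t0 [i j] _|t t0 i j]; [exact: t0|exact: (t0 (i, j))].
apply: fin_bigcap_measurable => // -[i j] _.
rewrite -[X in measurable X]setTI; apply: measurable_fun_le => //.
exact: measurable_ds_of.
Qed.

Lemma birkhoff_cube n : @birkhoff n `<=` @unit_cube R (n * n).
Proof.
move=> t t0 k; case/mxvec_indexP: k => i j; rewrite -tuple_mxE -complete_mxSS t0/=.
rewrite -(complete_mx_row (tuple_mx t) (lift ord0 i)).
rewrite (bigD1 (lift ord0 j))//= lerDl; apply: sumr_ge0 => l _; exact: t0.
Qed.

Lemma ds_of_midpoint n (s t : (n * n).-tuple (measurableTypeR R)) i j :
  ds_of (midpoint s t) i j = (ds_of s i j + ds_of t i j) / 2.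
Proof.
have tE k l : tuple_mx (midpoint s t) k l = (tuple_mx s k l + tuple_mx t k l) / 2.
  by rewrite !tuple_mxE tnth_mktuple.
have half (x y : R) : 1 - (x + y) / 2 = ((1 - x) + (1 - y)) / 2 by field.
have mE l : 1 - \sum_k tuple_mx (midpoint s t) k l =
    ((1 - \sum_k tuple_mx s k l) + (1 - \sum_k tuple_mx t k l)) / 2.
  by under eq_bigr do rewrite tE; rewrite -mulr_suml big_split/= half.
rewrite /ds_of.
have [k ->|->] := unliftP ord0 i; have [l ->|->] := unliftP ord0 j.
- by rewrite !complete_mxSS tE.
- rewrite !complete_mxS0; under eq_bigr do rewrite tE.
  by rewrite -mulr_suml big_split/= half.
- by rewrite !complete_mx0S mE.
- rewrite !complete_mx00; under eq_bigr do rewrite mE.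
  by rewrite -mulr_suml big_split/= half.
Qed.

(** * Exchanging a column with the deleted one *)

Lemma mxvec_index_eq n (i j k l : 'I_n) :
  (mxvec_index i j == mxvec_index k l) = (i == k) && (j == l).
Proof.
have [f fK _] := @curry_mxvec_bij n n.
have inj : injective (uncurry (@mxvec_index n n)).
  by apply: (@can_inj _ _ _ f) => x; exact: fK.
exact: (inj_eq inj (i, j) (k, l)).
Qed.

(* In minor coordinates, exchanging column [j] with the deleted column replaces
   the entries [(i, j)] by the deleted ones; doing it for one row [i] at a time
   makes it a composition of reflections in a single coordinate. *)
Definition fold_rows n (j : 'I_n) (s : seq 'I_n)
    (t : (n * n).-tuple (measurableTypeR R)) : (n * n).-tuple (measurableTypeR R) :=
  mx_tuple (\matrix_(i, l) if (l == j) && (i \in s) then 1 - \sum_m tuple_mx t i m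
                           else tuple_mx t i l).

Lemma measurable_fold_rows n (j : 'I_n) s : measurable_fun setT (fold_rows j s).
Proof.
apply/measurable_fun_tnthP => k; case/mxvec_indexP: k => i l.
have -> : @tnth (n * n) (measurableTypeR R) ^~ (mxvec_index i l) \o fold_rows j s =
    fun t => if (l == j) && (i \in s) then ds_of t (lift ord0 i) ord0
             else ds_of t (lift ord0 i) (lift ord0 l).
  by apply/funext => t /=; rewrite mx_tupleE mxE /ds_of complete_mxS0 complete_mxSS.
by case: ((l == j) && (i \in s)); exact: measurable_ds_of.
Qed.

(** Rows do not interact: reflecting the coordinate [(i, j)] changes row [i] only, and since [s] has
    no repetition the remaining folds never read that row. *)
Lemma lebesgue_tuple_fold_rows n (j : 'I_n) s
    (A : set ((n * n).-tuple (measurableTypeR R))) :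
  uniq s -> measurable A ->
  lebesgue_tuple [set t | A (fold_rows j s t)] = lebesgue_tuple A.
Proof.
elim: s => [_ _|i s IH /= /andP[is_ us] mA].
  have E t : fold_rows j [::] t = t.
    rewrite -[RHS]tuple_mxK; congr mx_tuple; apply/matrixP => i l.
    by rewrite mxE in_nil andbF.
  by congr lebesgue_tuple; apply/seteqP; split=> t /=; rewrite E.
(* The sum omits [j], so [g] does not involve the coordinate [(i, j)]; subtracting that coordinate
   from [g t] leaves the deleted entry of row [i]. *)
pose g (t : (n * n).-tuple (measurableTypeR R)) := 1 - \sum_(m | m != j) tuple_mx t i m.
have mg : measurable_fun setT g.
  apply: measurable_funB; first exact: measurable_cst.
  rewrite (_ : (fun _ => _) = fun t =>
    \sum_(m <- [seq m <- index_enum 'I_n | m != j]) tnth t (mxvec_index i m)).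
    by apply: measurable_sum => m; exact: measurable_tnth.
  by apply/funext => t; rewrite big_filter; apply: eq_bigr => m _; rewrite tuple_mxE.
have gj (u t : (n * n).-tuple (measurableTypeR R)) :
    (forall k, k != mxvec_index i j -> tnth u k = tnth t k) -> g u = g t.
  move=> ut; congr (_ - _); apply: eq_bigr => m mj; rewrite !tuple_mxE; apply: ut.
  by rewrite mxvec_index_eq eqxx.
have mB : measurable [set t | A (fold_rows j s t)].
  by have := measurable_fold_rows j s measurableT mA; rewrite setTI.
rewrite -IH// -(lebesgue_tuple_reflect_coord mg gj mB).
have E t : fold_rows j (i :: s) t =
    fold_rows j s (reflect_coord (mxvec_index i j) g t).
  set u := reflect_coord _ _ _.
  have uE k l : tuple_mx u k l = if (k == i) && (l == j)
      then 1 - \sum_m tuple_mx t i m else tuple_mx t k l.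
    rewrite tuple_mxE tnth_mktuple mxvec_index_eq; case: ifPn => _.
      by rewrite /g [in RHS](bigD1 j)//= opprD addrA addrAC tuple_mxE.
    by rewrite tuple_mxE.
  congr mx_tuple; apply/matrixP => k l; rewrite [LHS]mxE [RHS]mxE uE in_cons.
  have [->|lj] /= := eqVneq l j; last by rewrite andbF.
  have [->|ki] /= := eqVneq k i; first by rewrite (negbTE is_).
  case: ifPn => // _.
  by congr (_ - _); apply: eq_bigr => m _; rewrite uE (negbTE ki).
by congr lebesgue_tuple; apply/seteqP; split=> t /=; rewrite E.
Qed.

Definition swap_col n (j : 'I_n) (t : (n * n).-tuple (measurableTypeR R)) :=
  minor_coords (xcol ord0 (lift ord0 j) (ds_of t)).

Lemma ds_of_swap_col n (j : 'I_n) t :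
  ds_of (swap_col j t) = xcol ord0 (lift ord0 j) (ds_of t).
Proof.
apply: minor_coordsK => [i|l].
  under eq_bigr do rewrite mxE.
  by rewrite -[RHS](complete_mx_row (tuple_mx t) i) [RHS](reindex_inj (@perm_inj _ (tperm ord0 (lift ord0 j)))).
by under eq_bigr do rewrite mxE; exact: complete_mx_col.
Qed.

Lemma lebesgue_tuple_swap_col n (j : 'I_n) (A : set ((n * n).-tuple (measurableTypeR R))) :
  measurable A -> lebesgue_tuple [set t | A (swap_col j t)] = lebesgue_tuple A.
Proof.
move=> mA; rewrite -(lebesgue_tuple_fold_rows j (enum_uniq 'I_n) mA).
have E t : swap_col j t = fold_rows j (enum 'I_n) t.
  rewrite /swap_col minor_coords_mx_tuple; congr mx_tuple; apply/matrixP => i l.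
  rewrite minorE [LHS]mxE [RHS]mxE mem_enum inE andbT.
  have [->|lj] := eqVneq l j; first by rewrite tpermR complete_mxS0.
  rewrite tpermD ?complete_mxSS//.
  by rewrite (inj_eq (@lift_inj _ _)) eq_sym.
by congr lebesgue_tuple; apply/seteqP; split=> t /=; rewrite E.
Qed.

End fill.

(** * Volumes of slices *)

Section volume.
Context {R : realType}.
Implicit Types (n : nat).

(** Unnormalised, so that all estimates are between real volumes; the division by the volume of the
    polytope waits until [uniform_dsE]. *)
Definition vol n (A : set ((n * n).-tuple (measurableTypeR R))) : R :=
  fine (lebesgue_tuple (@birkhoff R n `&` A)).

Lemma volE n (A : set ((n * n).-tuple (measurableTypeR R))) :
  measurable A -> lebesgue_tuple (@birkhoff R n `&` A) = (vol A)%:E.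
Proof.
move=> mA; rewrite fineK// ge0_fin_numE//.
apply: le_lt_trans (ltry 1); apply: lebesgue_tuple_unit_cube.
  by apply: measurableI => //; exact: measurable_birkhoff.
by move=> t [/birkhoff_cube].
Qed.

Lemma vol_ge0 n (A : set ((n * n).-tuple (measurableTypeR R))) : 0 <= vol A.
Proof. by rewrite fine_ge0. Qed.

(** Integrates a pointwise inequality of step functions over the polytope. It yields the Riemann sum
    bound, the packing of translates and the union bounds alike, without decompositions into
    disjoint sets. *)
Lemma le_sum_vol n (I J : finType) (c : I -> R) (d : J -> R)
    (A : I -> set ((n * n).-tuple (measurableTypeR R)))
    (B : J -> set ((n * n).-tuple (measurableTypeR R))) :
  (forall i, 0 <= c i) -> (forall j, 0 <= d j) ->
  (forall i, measurable (A i)) -> (forall j, measurable (B j)) ->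
  (forall t, birkhoff t -> \sum_i c i * \1_(A i) t <= \sum_j d j * \1_(B j) t) ->
  \sum_i c i * vol (A i) <= \sum_j d j * vol (B j).
Proof.
move=> c0 d0 mA mB cd.
have mterm (e : R) (D : set ((n * n).-tuple (measurableTypeR R))) :
    measurable D -> measurable_fun (@birkhoff R n) (fun t => e * \1_D t).
  by move=> mD; apply: measurable_funM; [exact: measurable_cst|exact: measurable_indic].
have sumE (K : finType) (e : K -> R) (D : K -> set ((n * n).-tuple (measurableTypeR R))) :
    (forall k, 0 <= e k) -> (forall k, measurable (D k)) ->
    ((\sum_k e k * vol (D k))%:E = \int[@lebesgue_tuple R (n * n)]_(t in @birkhoff R n)
      (\sum_k e k * \1_(D k) t)%:E)%E.
  move=> e0 mD; under [RHS]eq_integral do rewrite -sumEFin.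
  rewrite ge0_integral_sum//=.
  - rewrite -sumEFin; apply: eq_bigr => k _.
    under eq_integral do rewrite EFinM.
    rewrite ge0_integralZl_EFin//.
    + by rewrite integral_indic//= 1?setIC ?volE// ?EFinM//; exact: measurable_birkhoff.
    + exact: measurable_birkhoff.
    + by apply/measurable_EFinP; exact: measurable_indic.
  - exact: measurable_birkhoff.
  - by move=> k; apply/measurable_EFinP; apply: mterm.
  - by move=> k t _; rewrite lee_fin mulr_ge0.
rewrite -lee_fin !sumE//; apply: ge0_le_integral.
- exact: measurable_birkhoff.
- by move=> t _; rewrite lee_fin; apply: sumr_ge0 => i _; rewrite mulr_ge0.
- by apply/measurable_EFinP; apply: measurable_sum => i; apply: mterm.
- by apply/measurable_EFinP; apply: measurable_sum => i; apply: mterm.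
- by move=> t Kt; rewrite lee_fin; exact: cd.
Qed.

Lemma le_vol n (A B : set ((n * n).-tuple (measurableTypeR R))) :
  measurable A -> measurable B -> (forall t, birkhoff t -> A t -> B t) -> vol A <= vol B.
Proof.
move=> mA mB AB; rewrite -lee_fin -!volE//; apply: le_measure; rewrite ?inE.
- by apply: measurableI => //; exact: measurable_birkhoff.
- by apply: measurableI => //; exact: measurable_birkhoff.
- by move=> t [Kt At]; split => //; exact: AB.
Qed.

Lemma measurable_entry_ge n (i j : 'I_n.+1) (c : R) :
  measurable [set t : (n * n).-tuple (measurableTypeR R) | c <= ds_of t i j].
Proof.
rewrite -[X in measurable X]setTI; apply: measurable_fun_le => //.
exact: measurable_ds_of.
Qed.

Lemma measurable_entry_le n (i j : 'I_n.+1) (c : R) :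
  measurable [set t : (n * n).-tuple (measurableTypeR R) | ds_of t i j <= c].
Proof.
rewrite -[X in measurable X]setTI; apply: measurable_fun_le => //.
exact: measurable_ds_of.
Qed.

Lemma vol_entry_ge n (j : 'I_n.+1) (c : R) :
  vol [set t : (n * n).-tuple (measurableTypeR R) | c <= ds_of t ord0 j] =
  vol [set t : (n * n).-tuple (measurableTypeR R) | c <= ds_of t ord0 ord0].
Proof.
have [k ->|->//] := unliftP ord0 j; rewrite /vol; congr fine.
rewrite -[RHS](lebesgue_tuple_swap_col k); last first.
  by apply: measurableI; [exact: measurable_birkhoff|exact: measurable_entry_ge].
congr lebesgue_tuple; apply/seteqP; split=> t [Kt /= ct]; split=> /=.
- by move=> i l; rewrite ds_of_swap_col mxE; exact: Kt.
- by rewrite ds_of_swap_col mxE tpermL.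
- move=> i l; have := Kt i (tperm ord0 (lift ord0 k) l).
  by rewrite ds_of_swap_col mxE tpermK.
- by move: ct; rewrite ds_of_swap_col mxE tpermL.
Qed.

(** For [d > 0] the sum is [x] rounded down to a multiple of [d] and capped at [m * d]. *)
Lemma sum_levels_le (m : nat) (d x : R) : 0 <= d -> 0 <= x ->
  \sum_(k < m) d * (k.+1%:R * d <= x)%R%:R <= x.
Proof.
move=> d0 x0; elim: m => [|m IH]; first by rewrite big_ord0.
rewrite big_ord_recr /=; have [mx|_] := leP (m.+1%:R * d) x; last by rewrite mulr0n mulr0 addr0.
apply: le_trans mx; rewrite mulr1n mulr1 -natr1 mulrDl mul1r lerD2r.
apply: (@le_trans _ _ (\sum_(k < m) d)); last by rewrite sumr_const card_ord mulr_natl.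
apply: ler_sum => k _; case: (k.+1%:R * d <= x); last by rewrite mulr0n mulr0.
by rewrite mulr1n mulr1.
Qed.

Lemma sum_vol_levels n m (d : R) : 0 <= d ->
  n.+1%:R * (\sum_(k < m) d *
    vol [set t : (n * n).-tuple (measurableTypeR R) | k.+1%:R * d <= ds_of t ord0 ord0]) <=
  vol [set: (n * n).-tuple (measurableTypeR R)].
Proof.
move=> d0.
have := @le_sum_vol n ('I_n.+1 * 'I_m)%type 'I_1 (fun _ => d) (fun _ => 1)
  (fun p => [set t | p.2.+1%:R * d <= ds_of t ord0 p.1]) (fun _ => setT) (fun _ => d0)
  (fun _ => ler01) (fun p => measurable_entry_ge _ _ _) (fun _ => measurableT).
have -> : \sum_(p : 'I_n.+1 * 'I_m) d *
    vol [set t | p.2.+1%:R * d <= ds_of t ord0 p.1] =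
  n.+1%:R * (\sum_(k < m) d *
    vol [set t : (n * n).-tuple (measurableTypeR R) | k.+1%:R * d <= ds_of t ord0 ord0]).
  rewrite -(pair_bigA _ (fun j (k : 'I_m) => d * vol [set t | k.+1%:R * d <= ds_of t ord0 j]))/=.
  under eq_bigr do under eq_bigr do rewrite vol_entry_ge.
  by rewrite sumr_const card_ord mulr_natl.
rewrite big_ord1 mul1r; apply => t Kt.
rewrite big_ord1 mul1r indicT/=.
rewrite -(pair_bigA _ (fun j (k : 'I_m) => d * \1_[set t | k.+1%:R * d <= ds_of t ord0 j] t))/=.
rewrite -[leRHS](complete_mx_row (tuple_mx t) ord0); apply: ler_sum => j _.
apply: le_trans (sum_levels_le m d0 (Kt ord0 j)); apply: ler_sum => k _.
by rewrite indicE; have [/set_mem /= ->|_] := boolP (_ \in _); rewrite ?mulr0 ?mulr_ge0.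
Qed.

(** The entries of [ds_of] are affine in the coordinates, so midpoints stay in the polytope and
    average the corner entry. *)
Lemma vol_log_concave n (a b : R) :
  vol [set t : (n * n).-tuple (measurableTypeR R) | a <= ds_of t ord0 ord0] *
  vol [set t : (n * n).-tuple (measurableTypeR R) | b <= ds_of t ord0 ord0] <=
  vol [set t : (n * n).-tuple (measurableTypeR R) | (a + b) / 2 <= ds_of t ord0 ord0] ^+ 2.
Proof.
rewrite expr2 -lee_fin !EFinM -!volE; try exact: measurable_entry_ge.
have mK c : measurable (@birkhoff R n `&` [set t | c <= ds_of t ord0 ord0]).
  by apply: measurableI; [exact: measurable_birkhoff|exact: measurable_entry_ge].
have Kc c : @birkhoff R n `&` [set t | c <= ds_of t ord0 ord0] `<=` @unit_cube R (n * n).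
  by move=> t [/birkhoff_cube].
apply: brunn_minkowski; [exact: mK|exact: mK|exact: mK|exact: Kc|exact: Kc|exact: Kc|].
move=> s t [Ks /= sa] [Kt /= tb]; split=> [i j|/=].
  by rewrite ds_of_midpoint divr_ge0// addr_ge0.
by rewrite ds_of_midpoint ler_pM2r ?invr_gt0// lerD.
Qed.

(** A log-concave sequence lies above the geometric interpolation of its end values. Terms may
    vanish, so logarithms and quotients are avoided, and monotonicity carries a zero on to all later
    indices. *)
Lemma log_concave_ge_geometric (a : nat -> R) (q : R) m :
  (forall k, 0 <= a k) -> (forall k, a k.+1 <= a k) ->
  (forall k, a k * a k.+2 <= a k.+1 ^+ 2) ->
  0 < q -> q ^+ m * a 0 < a m ->
  forall k, (k <= m)%N -> q ^+ k * a 0 <= a k.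
Proof.
move=> a0 adec alc q0 am.
(* Once the sequence drops below the geometric one, log-concavity keeps its
   ratios at most [q], so it stays below. *)
have below j : a j < q ^+ j * a 0 -> (0 < j)%N && (a j <= q * a j.-1) ->
    forall i, (j <= i)%N -> a i < q ^+ i * a 0 \/ a i = 0.
  move=> aj /andP[j0 ajq].
  have step i : (a (j + i)%N < q ^+ (j + i) * a 0 /\ a (j + i)%N <= q * a (j + i).-1)
      \/ a (j + i)%N = 0.
    elim: i => [|i [[IH1 IH2]|IH]]; first by rewrite addn0; left.
    - have [ai0|ai0] := eqVneq (a (j + i)%N) 0; last first.
        have apos : 0 < a (j + i)%N by rewrite lt0r ai0 a0.
        left; rewrite addnS /=.
        have : a (j + i).+1 <= q * a (j + i)%N.
          have := alc (j + i).-1; rewrite prednK ?addn_gt0 ?j0// => alc'.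
          have apred : 0 < a (j + i).-1.
            by rewrite -(pmulr_rgt0 _ q0); apply: lt_le_trans IH2.
          rewrite -(ler_pM2l apred); apply: le_trans alc' _.
          by rewrite expr2 mulrA ler_pM2r// mulrC.
        move=> h; split=> //; apply: le_lt_trans h _.
        by rewrite exprS -mulrA ltr_pM2l.
      by right; apply/eqP; rewrite eq_le a0 andbT addnS -[leRHS]ai0.
    - by right; apply/eqP; rewrite eq_le a0 andbT addnS -[leRHS]IH.
  move=> i ji; have := step (i - j)%N; rewrite subnKC//.
  by move=> [[]|]; [left|right].
elim=> [_|k IH km]; first by rewrite expr0 mul1r.
rewrite leNgt; apply/negP => ak.
(* The sequence is still above the geometric one at [k] and below it at [k.+1], so this step has
   ratio at most [q], which starts the descent in [below] down to index [m]. *)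
have ak1 : (0 < k.+1)%N && (a k.+1 <= q * a k.+1.-1).
  apply/andP; split=> //=; apply/ltW/(lt_le_trans ak).
  by rewrite exprS -mulrA ler_pM2l// IH// ltnW.
have [|am0] := below _ ak ak1 m km; first by rewrite ltNge ltW.
by move: am; rewrite am0 ltNge mulr_ge0// exprn_ge0// ltW.
Qed.

End volume.

(** * Tail bounds *)

Section tails.
Context {R : realType}.
Implicit Types (n : nat).

Lemma vol_upper_tail n (T : R) : 0 < T -> expR (- (T / 2)) <= 4^-1 ->
  vol [set t : (n * n).-tuple (measurableTypeR R) | T / n.+1%:R <= ds_of t ord0 ord0] <=
  expR (- (T / 2)) * vol [set: (n * n).-tuple (measurableTypeR R)].
Proof.
move=> T0 T4.
(* More than [2 * T] steps, so that the mesh [h] of the variable [u] is below 1/2. *)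
pose m := (Num.truncn (2 * T)).+1.
have m0 : 0 < m%:R :> R by rewrite ltr0n.
have n0 : 0 < n.+1%:R :> R by rewrite ltr0n.
have mT : 2 * T < m%:R by rewrite truncnS_gt.
pose h := T / m%:R.
have hm : m%:R * h = T by rewrite /h mulrCA divff ?mulr1// gt_eqF.
have h0 : 0 < h by rewrite divr_gt0.
have h2 : h < 2^-1 by rewrite /h ltr_pdivrMr// mulrC ltr_pdivlMr// mulrC.
clearbody h m.
pose d := h / n.+1%:R.
have d0 : 0 < d by rewrite divr_gt0.
pose a k := vol [set t : (n * n).-tuple (measurableTypeR R) |
  k%:R * d <= ds_of t ord0 ord0].
have -> : [set t : (n * n).-tuple (measurableTypeR R) | T / n.+1%:R <= ds_of t ord0 ord0] =
    [set t | m%:R * d <= ds_of t ord0 ord0] by rewrite /d mulrA hm.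
have aT : vol [set: (n * n).-tuple (measurableTypeR R)] = a 0.
  apply/eqP; rewrite eq_le; apply/andP; split; apply: le_vol => //.
  - exact: measurable_entry_ge.
  - by move=> t Kt _ /=; rewrite mul0r.
  - exact: measurable_entry_ge.
pose q := expR (- (h / 2)).
have qm : expR (- (T / 2)) = q ^+ m.
  by rewrite /q -expRM_natl -[in LHS]hm mulrN mulrA.
have q0 : 0 < q by exact: expR_gt0.
have qh : 1 - h / 2 <= q by apply: le_trans (expR_ge1Dx _); rewrite lexx.
rewrite aT qm -/(a m) leNgt; apply/negP => am.
have adec k : a k.+1 <= a k.
  apply: le_vol; [exact: measurable_entry_ge|exact: measurable_entry_ge|].
  by move=> t _ /= kt; apply: le_trans kt; rewrite ler_pM2r// ler_nat.
have alc k : a k * a k.+2 <= a k.+1 ^+ 2.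
  have := @vol_log_concave R n (k%:R * d) (k.+2%:R * d).
  by rewrite (_ : (k%:R * d + k.+2%:R * d) / 2 = k.+1%:R * d)// -!natr1; field.
have a_ge0 k : 0 <= a k by exact: vol_ge0.
have geo := log_concave_ge_geometric a_ge0 adec alc q0 am.
have a00 : 0 < a 0.
  rewrite lt0r a_ge0 andbT; apply/eqP => a0.
  have am0 k : a k <= a 0 by elim: k => // k IHk; exact: le_trans IHk.
  by move: am; rewrite a0 mulr0 -[ltLHS]a0 ltNge am0.
have := sum_vol_levels n m (ltW d0).
rewrite aT; apply/negP; rewrite -ltNge.
apply: (@lt_le_trans _ _ (n.+1%:R * (\sum_(k < m) d * (q ^+ k.+1 * a 0)))); last first.
  rewrite ler_pM2l//; apply: ler_sum => k _; rewrite ler_pM2l//.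
  exact: geo.
rewrite -mulr_sumr -mulr_suml mulrA [n.+1%:R * d]mulrC /d divfK ?gt_eqF//.
rewrite mulrA -[ltLHS]mul1r ltr_pM2r//.
have -> : \sum_(k < m) q ^+ k.+1 = q * \sum_(k < m) q ^+ k.
  by rewrite mulr_sumr; apply: eq_bigr => k _; rewrite exprS.
have q1 : q < 1 by rewrite expR_lt1 oppr_lt0 divr_gt0.
(* The factor [1 - q] sums the geometric series without a division. *)
rewrite -(@ltr_pM2l _ (1 - q)) ?subr_gt0// mulr1.
have -> : (1 - q) * (h * (q * \sum_(k < m) q ^+ k)) = h * q * (1 - q ^+ m).
  by rewrite -[1 - q ^+ m]opprB subrX1; ring.
rewrite -qm; set e := expR _ in T4 *.
(* It remains to see [1 - q < h * q * (1 - e)]. The left side is at most [h / 2], while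
   [q >= 1 - h / 2 > 3 / 4] and [1 - e >= 3 / 4] make the right side exceed [9 * h / 16]. *)
have e0 : 0 <= 4^-1 - e by lra.
have hq : 0 < h * q by exact: mulr_gt0.
have : 0 <= h * q * (4^-1 - e) by rewrite mulr_ge0// ltW.
have : 0 <= h * (q - (1 - h / 2)) by rewrite mulr_ge0 ?subr_ge0// ltW.
have : 0 < h * (2^-1 - h) by rewrite mulr_gt0// subr_gt0.
by nra.
Qed.

(** * Translations of one coordinate and the lower tail *)

Definition shift_coord n (k : 'I_n) (s : R) (t : n.-tuple (measurableTypeR R)) :
    n.-tuple (measurableTypeR R) :=
  [tuple if i == k then tnth t i + s else tnth t i | i < n].

Lemma shift_coordE n (k : 'I_n) (s : R) t :
  shift_coord k s t = reflect_coord k (fun=> s) (reflect_coord k (fun=> 0) t).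
Proof.
apply/eq_from_tnth => i; rewrite !tnth_mktuple eqxx; case: eqVneq => [->|//].
by rewrite sub0r opprK addrC.
Qed.

Lemma measurable_shift_coord n (k : 'I_n) (s : R) :
  measurable_fun setT (shift_coord k s).
Proof.
have -> : shift_coord k s = reflect_coord k (fun=> s) \o reflect_coord k (fun=> 0).
  by apply/funext => t; exact: shift_coordE.
by apply: measurableT_comp; apply: measurable_reflect_coord; exact: measurable_cst.
Qed.

Lemma lebesgue_tuple_shift_coord n (k : 'I_n) (s : R)
    (A : set (n.-tuple (measurableTypeR R))) :
  measurable A -> lebesgue_tuple [set t | A (shift_coord k s t)] = lebesgue_tuple A.
Proof.
move=> mA; under eq_set do rewrite shift_coordE.
have mc (c : R) : measurable_fun setT (fun _ : n.-tuple (measurableTypeR R) => c).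
  exact: measurable_cst.
have mB : measurable [set t | A (reflect_coord k (fun=> s) t)].
  by have := measurable_reflect_coord k (mc s) measurableT mA; rewrite setTI.
rewrite -[RHS](lebesgue_tuple_reflect_coord (k := k) (g := fun=> s))//.
by rewrite -[RHS](lebesgue_tuple_reflect_coord (k := k) (g := fun=> 0)).
Qed.

(* Adding [s * (signs i a * signs j b)] to the entries [(a, b)] preserves all
   line sums and changes the single entry [(i, j)] of the minor. *)
Definition signs n (i : 'I_n) (a : 'I_n.+1) : R := (a == lift ord0 i)%:R - (a == ord0)%:R.

Lemma signs_lift n (i k : 'I_n) : signs i (lift ord0 k) = (k == i)%:R.
Proof.
rewrite /signs (inj_eq (@lift_inj _ _)) [lift ord0 k == ord0]eq_sym.
by rewrite (negbTE (neq_lift _ _)) mulr0n subr0.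
Qed.

Lemma signs0 n (i : 'I_n) : signs i ord0 = -1.
Proof. by rewrite /signs (negbTE (neq_lift _ _)) eqxx mulr0n mulr1n sub0r. Qed.

Lemma sum_signs n (i : 'I_n) : \sum_a signs i a = 0.
Proof.
have delta (b : 'I_n.+1) : \sum_(a < n.+1) (a == b)%:R = 1 :> R.
  rewrite (bigD1 b)//= eqxx big1 ?addr0// => a /negbTE ->.
  by rewrite mulr0n.
by rewrite sumrB !delta subrr.
Qed.

(** The right-hand side has line sums 1 and the shifted minor, hence [minor_coordsK] identifies it.
    The corner has sign [(-1) * (-1)], so it grows by [s] along with the entry [(i, j)] of the
    minor. *)
Lemma ds_of_shift_coord n (i j : 'I_n) (s : R) t (a b : 'I_n.+1) :
  ds_of (shift_coord (mxvec_index i j) s t) a b =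
  ds_of t a b + s * (signs i a * signs j b).
Proof.
pose X : 'M[R]_n.+1 := \matrix_(a, b) (ds_of t a b + s * (signs i a * signs j b)).
have XE c d : X c d = ds_of t c d + s * (signs i c * signs j d) by rewrite [LHS]mxE.
have -> : shift_coord (mxvec_index i j) s t = minor_coords X.
  apply/eq_from_tnth => k; case/mxvec_indexP: k => k l.
  rewrite minor_coordsE XE tnth_mktuple mxvec_index_eq /ds_of complete_mxSS tuple_mxE.
  rewrite !signs_lift; case: (k == i); case: (l == j) => /=;
    by rewrite ?mulr1n ?mulr0n ?mulr1 ?mul0r ?mulr0 ?addr0.
rewrite -XE minor_coordsK// => c.
  under eq_bigr do rewrite XE.
  rewrite big_split/= complete_mx_row -2!mulr_sumr sum_signs !mulr0.
  by rewrite addr0.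
under eq_bigr do rewrite XE.
by rewrite big_split/= complete_mx_col -mulr_sumr -mulr_suml sum_signs mul0r mulr0 addr0.
Qed.

Lemma measurable_entry_lt n (i j : 'I_n.+1) (c : R) :
  measurable [set t : (n * n).-tuple (measurableTypeR R) | ds_of t i j < c].
Proof.
rewrite (_ : [set t | _] = ~` [set t : (n * n).-tuple (measurableTypeR R) | c <= ds_of t i j]).
  by apply: measurableC; exact: measurable_entry_ge.
by apply/seteqP; split=> t /=; rewrite ltNge; [move/negP|move=> ?; apply/negP].
Qed.

Lemma sum_disjoint_cells_le1 M (e x : R) (P : 'I_M -> bool) :
  (forall l, P l -> l%:R * e <= x < l.+1%:R * e) -> \sum_l (P l)%:R <= 1 :> R.
Proof.
move=> Px; have [/existsP[l Pl]|/existsPn nP] := boolP [exists l, P l]; last first.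
  by rewrite big1 ?ler01// => l _; rewrite (negbTE (nP l)).
rewrite (bigD1 l)//= Pl big1 ?addr0// => k kl.
apply/eqP; rewrite pnatr_eq0 eqb0; apply/negP => Pk.
have e0 : 0 < e.
  have /andP[h1 h2] := Px _ Pl; have := le_lt_trans h1 h2.
  by rewrite -subr_gt0 -mulrBl -natrB// subSnn mul1r.
have lt_of a b : P a -> P b -> (a <= b)%N.
  move=> /Px/andP[h1 _] /Px/andP[_ h2]; have := le_lt_trans h1 h2.
  by rewrite ltr_pM2r// ltr_nat ltnS.
by move: kl; rewrite -val_eqE eqn_leq !lt_of.
Qed.

(** The bound [d] is the reserve from which a translation by up to [d] is paid, as it decreases
    precisely these two border entries. *)
Definition lower_cell n (e d : R) (i j : 'I_n) : set ((n * n).-tuple (measurableTypeR R)) :=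
  [set t | [/\ ds_of t ord0 ord0 < e, d <= ds_of t ord0 (lift ord0 j) &
               d <= ds_of t (lift ord0 i) ord0]].

Lemma measurable_lower_cell n (e d : R) (i j : 'I_n) : measurable (lower_cell e d i j).
Proof.
rewrite (_ : lower_cell _ _ _ _ =
    [set t : (n * n).-tuple (measurableTypeR R) | ds_of t ord0 ord0 < e] `&`
    [set t : (n * n).-tuple (measurableTypeR R) | d <= ds_of t ord0 (lift ord0 j)] `&`
    [set t : (n * n).-tuple (measurableTypeR R) | d <= ds_of t (lift ord0 i) ord0]).
  by apply: measurableI; [apply: measurableI|]; [exact: measurable_entry_lt|
    exact: measurable_entry_ge|exact: measurable_entry_ge].
by apply/seteqP; split=> t /= => [[? ? ?]|[[? ?] ?]].
Qed.

(* The translates of the cell by [l * e] along the pattern [signs i], [signs j],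
   for [l < M], are disjoint and contained in the polytope. *)
Lemma vol_lower_cell n (i j : 'I_n) M (e d : R) : M%:R * e <= d ->
  M%:R * vol (lower_cell e d i j) <= vol [set: (n * n).-tuple (measurableTypeR R)].
Proof.
move=> Med; set A := lower_cell e d i j.
have mA : measurable A by exact: measurable_lower_cell.
have mKA : measurable (@birkhoff R n `&` A).
  by apply: measurableI => //; exact: measurable_birkhoff.
(* The sign is negative because [B l] is a preimage under [sh l], hence the translate of the cell by
   [+ l * e]. *)
pose sh (l : 'I_M) := shift_coord (mxvec_index i j) (- (l%:R * e)).
pose B (l : 'I_M) := [set t | (@birkhoff R n `&` A) (sh l t)].
have mB l : measurable (B l).
  by have := measurable_shift_coord (mxvec_index i j) (- (l%:R * e)) measurableT mKA; rewrite setTI.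
have shE l t a b : ds_of t a b = ds_of (sh l t) a b + l%:R * e * (signs i a * signs j b).
  by rewrite ds_of_shift_coord mulNr subrK.
have e0 l t : B l t -> 0 < e.
  by move=> [K0 [+ _ _]]; apply: le_lt_trans; exact: K0.
have le_d (l : 'I_M) t : B l t -> l%:R * e <= d.
  move=> /e0 e_gt0; apply: le_trans Med; rewrite ler_pM2r// ler_nat.
  exact/ltnW/ltn_ord.
have BK l : B l `<=` @birkhoff R n.
  move=> t Bt a b; have le0 : 0 <= l%:R * e by rewrite mulr_ge0// ltW// (e0 l t).
  have led := le_d _ _ Bt; case: Bt => Kt [_ dj di].
  rewrite (shE l t); have := Kt a b.
  (* Entries of the minor and the corner can only grow; a border entry loses at most [l * e <= d],
     and only where the cell guarantees at least [d]. *)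
  have [k ->|->] := unliftP ord0 a; have [k' ->|->] := unliftP ord0 b;
    rewrite ?signs_lift ?signs0.
  - by move=> ?; rewrite addr_ge0// mulr_ge0// mulr_ge0.
  - by case: eqVneq => [->|_] => ?; rewrite ?mulr1n ?mulr0n; lra.
  - by case: eqVneq => [->|_] => ?; rewrite ?mulr1n ?mulr0n; lra.
  - by lra.
have volB l : vol (B l) = vol A.
  rewrite /vol setIidr//; congr fine; exact: lebesgue_tuple_shift_coord.
have := @le_sum_vol R n 'I_M 'I_1 (fun=> 1) (fun=> 1) B (fun=> setT) (fun=> ler01)
  (fun=> ler01) mB (fun=> measurableT).
under eq_bigr do rewrite volB mul1r.
rewrite sumr_const card_ord big_ord1 mul1r mulr_natl; apply => t Kt.
under eq_bigr do rewrite mul1r indicE.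
rewrite big_ord1 mul1r indicT.
(* The corner separates the translates: on [B l] it lies in [[l * e, l.+1 * e[]. *)
apply: (@sum_disjoint_cells_le1 M e (ds_of t ord0 ord0) (fun l => t \in B l)) => l /set_mem.
move=> Bt; rewrite (shE l t) !signs0.
case: Bt => Kt' [lt_e _ _]; have := Kt' ord0 ord0.
by rewrite -natr1 mulrDl => ?; apply/andP; split; lra.
Qed.

Lemma vol_lower_tail n M (e : R) : (0 < n)%N -> (0 < M)%N -> 0 <= e ->
  M%:R * e <= (2 * n.+1%:R)^-1 ->
  M%:R * vol [set t : (n * n).-tuple (measurableTypeR R) | ds_of t ord0 ord0 < e] <=
  (n ^ 2)%:R * vol [set: (n * n).-tuple (measurableTypeR R)].
Proof.
move=> n0 M0 e0 Me; set d := (2 * _)^-1 in Me.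
pose A (p : 'I_n * 'I_n) := lower_cell e d p.1 p.2.
have mA p : measurable (A p) by exact: measurable_lower_cell.
have n10 : 0 < n.+1%:R :> R by rewrite ltr0n.
have ed : e <= d.
  by apply: le_trans Me; rewrite ler_peMl// ler1n.
(* If all [n] other entries of a line were below [d], then together with a corner below [e <= d]
   they would sum to at most [1 / 2] instead of 1. *)
have nd : n%:R * d + d = 2^-1.
  by rewrite -[X in _ + X]mul1r -mulrDl natr1 /d invfM mulrCA divff ?mulr1// gt_eqF.
have d0 : 0 < d by rewrite invr_gt0 mulr_gt0.
have big (f : 'I_n -> R) x : x < e -> x + \sum_k f k = 1 -> exists k, d <= f k.
  move=> xe xf; apply/not_existsP => fd.
  have : \sum_k f k <= \sum_(k < n) d.
    by apply: ler_sum => k _; rewrite leNgt; apply/negP => dk; apply: (fd k); exact: ltW.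
  rewrite sumr_const card_ord -mulr_natl => fnd; lra.
have := @le_sum_vol R n 'I_1 ('I_n * 'I_n)%type (fun=> 1) (fun=> 1)
  (fun=> [set t | ds_of t ord0 ord0 < e]) A (fun=> ler01) (fun=> ler01)
  (fun=> measurable_entry_lt _ _ _) mA.
rewrite big_ord1 mul1r => union; rewrite -(@ler_pM2l _ M%:R) ?ltr0n// in union.
apply: le_trans (union _) _ => [t Kt|].
  rewrite big_ord1 mul1r indicE; have [/set_mem /= te|_] := boolP (_ \in _); last first.
    by apply: sumr_ge0 => p _; rewrite mul1r indicE.
  have [j jd] : exists j, d <= ds_of t ord0 (lift ord0 j).
    by apply: (big _ _ te); rewrite -(complete_mx_row (tuple_mx t) ord0) big_ord_recl.
  have [i id] : exists i, d <= ds_of t (lift ord0 i) ord0.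
    by apply: (big _ _ te); rewrite -(complete_mx_col (tuple_mx t) ord0) big_ord_recl.
  rewrite (bigD1 (i, j))//= mul1r indicE mem_set//= mulr1n lerDl.
  by apply: sumr_ge0 => p _; rewrite mul1r indicE.
rewrite mulr_sumr; apply: (@le_trans _ _ (\sum_(p : 'I_n * 'I_n)
  vol [set: (n * n).-tuple (measurableTypeR R)])).
  by apply: ler_sum => p _; rewrite mul1r; exact: vol_lower_cell.
by rewrite sumr_const card_prod card_ord mulr_natl -[(n ^ 2)%N]mulnn.
Qed.

(** A box around the constant matrix [x = 1 / (n + 1)] lies in the polytope. The corner is the most
    sensitive entry: it moves by up to [n ^ 2 * y], and the radius [y = x ^ 3] keeps this below
    [x]. *)
Lemma vol_gt0 n : 0 < vol [set: (n * n).-tuple (measurableTypeR R)].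
Proof.
have n0 : 0 < n.+1%:R :> R by rewrite ltr0n.
pose x : R := n.+1%:R^-1.
have x0 : 0 < x by rewrite invr_gt0.
have nx : n%:R * x + x = 1 by rewrite -[X in _ + X]mul1r -mulrDl natr1 divff// gt_eqF.
pose y := x ^+ 3.
have y0 : 0 < y by rewrite exprn_gt0.
pose box : set ((n * n).-tuple (measurableTypeR R)) :=
  [set t | forall k, x - y <= tnth t k <= x + y].
have mbox : measurable box by exact: measurable_box.
have boxE t i j : box t -> x - y <= tuple_mx t i j <= x + y.
  by move=> bt; rewrite tuple_mxE; exact: bt.
have N0 : 0 <= n%:R :> R by [].
have nx0 : 0 <= n%:R * x by rewrite mulr_ge0// ltW.
have boxK : box `<=` @birkhoff R n.
  move=> t bt i j; rewrite /ds_of.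
  have up (f : 'I_n -> R) : (forall k, f k <= x + y) -> \sum_k f k <= n%:R * (x + y).
    by move=> fu; rewrite mulr_natl -[X in _ *+ X](card_ord n) -sumr_const; exact: ler_sum.
  have lo (f : 'I_n -> R) : (forall k, x - y <= f k) -> n%:R * (x - y) <= \sum_k f k.
    by move=> fl; rewrite mulr_natl -[X in _ *+ X](card_ord n) -sumr_const; exact: ler_sum.
  have nxx : (n%:R * x) * x <= x by nra.
  have nx1 : n%:R * x <= 1 by lra.
  have ny : n%:R * y <= x by rewrite /y !exprS expr0 mulr1; nra.
  have nny : n%:R * (n%:R * y) <= x by rewrite /y !exprS expr0 mulr1; nra.
  have yx : y <= x by rewrite /y !exprS expr0 mulr1; nra.
  have [k ->|->] := unliftP ord0 i; have [l ->|->] := unliftP ord0 j.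
  - by rewrite complete_mxSS; have := boxE t k l bt => /andP[]; lra.
  - rewrite complete_mxS0.
    have := up (fun l => tuple_mx t k l) (fun l => proj2 (andP (boxE t k l bt))).
    by rewrite mulrDr => ?; lra.
  - rewrite complete_mx0S.
    have := up (fun k => tuple_mx t k l) (fun k => proj2 (andP (boxE t k l bt))).
    by rewrite mulrDr => ?; lra.
  - rewrite complete_mx00 sumrB sumr_const card_ord.
    have lok j' := lo (fun k => tuple_mx t k j') (fun k => proj1 (andP (boxE t k j' bt))).
    have : \sum_(j' < n) n%:R * (x - y) <= \sum_(j' < n) \sum_k tuple_mx t k j'.
      by apply: ler_sum => j' _; exact: lok.
    rewrite sumr_const card_ord -mulr_natl => ?.
    have : n%:R * (n%:R * (x - y)) = n%:R - 1 + x - n%:R * (n%:R * y) by nra.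
    by lra.
rewrite -lte_fin -volE//= setIT; apply: (@lt_le_trans _ _ (lebesgue_tuple box)).
  rewrite lebesgue_tuple_box; last by move=> _; lra.
  by rewrite lte_fin; apply: prodr_gt0 => k _; lra.
by apply: le_measure; rewrite ?inE//; exact: measurable_birkhoff.
Qed.

End tails.

(** * From volumes to probabilities *)

Lemma uniform_dsE (R : realType) n (E : set 'M[R]_n.+1) :
  measurable [set t : (n * n).-tuple (measurableTypeR R) | E (ds_of t)] ->
  uniform_ds E = (vol [set t : (n * n).-tuple (measurableTypeR R) | E (ds_of t)] /
                  vol [set: (n * n).-tuple (measurableTypeR R)])%:E.
Proof.
move=> mE; rewrite /uniform_ds minor_coords_image volE//.
rewrite -[X in minor_coords (n:=n) @` X]setIT minor_coords_image.
rewrite (volE (measurableT : measurable [set: (n * n).-tuple (measurableTypeR R)])).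
by rewrite inver gt_eqF ?vol_gt0.
Qed.

Theorem theorem2p4 (R : realType) (B : R) (hB : 4 < B) :
  exists C : R, \forall n \near \oo,
    ((1 - C * n.+1%:R `^ (- (B / 2)))%:E <=
     uniform_ds (n := n)
       [set X : 'M[R]_n.+1 |
          (n.+1%:R `^ (- B) <= n.+1%:R * X ord0 ord0 <= B * ln n.+1%:R)%R])%E.
Proof.
(* The upper tail contributes [p] and the lower tail at most [4 * p]. *)
exists 5; near=> n.
have n_gt0 : (0 < n)%N by near: n; exists 1%N.
pose N : R := n.+1%:R; rewrite -/N.
have N2 : 2 <= N by rewrite ler_nat ltnS.
have N0 : 0 < N by lra.
have N1 : 1 <= N by lra.
have NN : 4 <= N * N by rewrite (_ : 4 = 2 * 2 :> R) ?ler_pM//; ring.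
pose T := B * ln N.
have T0 : 0 < T by rewrite mulr_gt0 ?ln_gt0//; lra.
pose p := N `^ (- (B / 2)).
have pT : expR (- (T / 2)) = p.
  by rewrite /p /powR gt_eqF// /T; congr expR; field.
have p4 : p <= 4^-1.
  rewrite /p powRN lef_pV2 ?posrE ?powR_gt0//.
  apply: (@le_trans _ _ (N `^ 2%:R)); last by apply: ler_powR => //; lra.
  by rewrite powR_mulrn ?(ltW N0)// expr2.
have p0 : 0 < p by exact: powR_gt0.
(* The largest number of translates by [e = N ^ (- B) / N] that fits into [1 / (2 * N)], before
   rounding. *)
pose y := N `^ B / 2.
(* The exponents compare as [2 - B <= - (B / 2)], which is where [4 < B] enters. *)
have yp : N `^ 2%:R * y^-1 <= 2 * p.
  rewrite /y invf_div mulrCA -powRN -powRD ?(gt_eqF N0) ?implybT//.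
  by rewrite ler_pM2l//; apply: ler_powR => //; lra.
have y2 : 2 <= y.
  rewrite /y ler_pdivlMr//; apply: (@le_trans _ _ (N `^ 2%:R)).
    by rewrite powR_mulrn ?(ltW N0)// expr2; lra.
  by apply: ler_powR => //; lra.
pose M := Num.truncn y.
have /andP[My yM] : M%:R <= y < M.+1%:R by apply: truncn_itv; lra.
(* Since [y >= 2], rounding down loses at most a factor 2; this turns [2 * p] into [4 * p] for the
   lower tail. *)
have M2 : y / 2 <= M%:R by move: yM; rewrite -natr1; lra.
have M0 : (0 < M)%N by rewrite -(ltr_nat R); lra.
pose e := N `^ (- B) / N.
have e0 : 0 < e by rewrite divr_gt0// powR_gt0.
have Me : M%:R * e <= (2 * N)^-1.
  apply: (@le_trans _ _ (y * e)); first by rewrite ler_pM2r.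
  rewrite /y /e powRN mulrACA divff ?gt_eqF ?powR_gt0//.
  by rewrite mul1r invfM.
have up := vol_upper_tail n T0 (eq_ind_r (fun x => x <= 4^-1) p4 pT).
have low := vol_lower_tail n_gt0 M0 (ltW e0) Me.
set K := vol [set: _] in up low; have K0 : 0 < K by exact: vol_gt0.
set U := vol _ in up; set L := vol _ in low.
set E : set 'M[R]_n.+1 := [set X | _]%classic.
have mE : measurable [set t : (n * n).-tuple (measurableTypeR R) | E (ds_of t)].
  rewrite (_ : [set t | _] =
    [set t : (n * n).-tuple (measurableTypeR R) | e <= ds_of t ord0 ord0] `&`
    [set t : (n * n).-tuple (measurableTypeR R) | ds_of t ord0 ord0 <= T / N]).
    by apply: measurableI; [exact: measurable_entry_ge|exact: measurable_entry_le].
  apply/seteqP; split=> t; rewrite /E /= -/N /e ler_pdivrMr// ler_pdivlMr// ![_ * N]mulrC.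
    by move=> /andP[].
  by move=> [-> ->].
rewrite uniform_dsE// lee_fin ler_pdivlMr// -/K -/p.
(* The three sets only need to cover the polytope, so the overlap of the first two on
   [ds_of t ord0 ord0 = T / N] is harmless. *)
have KEUL : K <= vol [set t | E (ds_of t)] + U + L.
  have := @le_sum_vol R n 'I_1 'I_3 (fun=> 1) (fun=> 1) (fun=> setT)
    (tnth [tuple [set t | E (ds_of t)]; [set t | T / N <= ds_of t ord0 ord0];
                 [set t | ds_of t ord0 ord0 < e]]) (fun=> ler01) (fun=> ler01)
    (fun=> measurableT).
  rewrite !big_ord_recl !big_ord0 !(tnth_nth setT) /= !mul1r !addr0 addrA; apply.
    move=> j; rewrite (tnth_nth setT); case: j => -[|[|[|//]]] /= _.
    - exact: mE.
    - exact: measurable_entry_ge.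
    - exact: measurable_entry_lt.
  move=> t Kt; rewrite !big_ord_recl !big_ord0 !(tnth_nth setT) /= !mul1r !addr0 indicT.
  have ind0 (A : set ((n * n).-tuple (measurableTypeR R))) : 0 <= \1_A t :> R by [].
  have ind1 (A : set ((n * n).-tuple (measurableTypeR R))) : A t -> \1_A t = 1 :> R.
    by move=> At; rewrite indicE mem_set.
  have [te|te] := ltP (ds_of t ord0 ord0) e.
    by rewrite [X in _ + (_ + X)]ind1//= addrA lerDr addr_ge0.
  have [tT|tT] := leP (T / N) (ds_of t ord0 ord0).
    by rewrite [X in _ + (X + _)]ind1//= addrCA lerDl addr_ge0.
  rewrite [X in X + _]ind1 ?lerDl ?addr_ge0//=.
  move: te tT; rewrite /E /= -/N /e ler_pdivrMr// ltr_pdivlMr// ![_ * N]mulrC.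
  by move=> -> /ltW ->.
have LK : L <= 4 * p * K.
  have M0' : 0 < M%:R :> R by rewrite ltr0n.
  rewrite -(ler_pM2l M0'); apply: le_trans low _; rewrite mulrA ler_pM2r//.
  apply: (@le_trans _ _ (N ^+ 2)).
    by rewrite natrX ler_pXn2r// ?nnegrE// ler_nat.
  move: yp; rewrite powR_mulrn ?(ltW N0)// ler_pdivrMr; last by lra.
  move=> /le_trans; apply; have : 0 <= p * (M%:R - y / 2) by rewrite mulr_ge0 ?subr_ge0// ltW.
  by nra.
move: up; rewrite pT -/K => up.
lra.
Unshelve. all: by end_near.
Qed.
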